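(* Let $(H,\alpha)$ be an involutive monoidal Hom-Hopf algebra and $(L,[\,,],\beta)$ an involutive braided Hom-Lie algebra in ${}^{H}_{H}\mathcal{HYD}$. Let $U(L)=T(L)/I$, where $I$ is the $H$-Hom-ideal of $T(L)$ generated by $$\{x\otimes y-(x_{(-1)}\cdot\beta(y))\otimes\beta(x_0)-[x,y]\ :\ x,y\in L\}.$$ Let $\psi:L\to U(L)$ be the composition of the natural inclusion $i:L\to T(L)$ with the canonical map $\pi:T(L)\to T(L)/I$. Then $(U(L),\psi,\beta_T)$ is a universal enveloping algebra of $L$.
   Context: Everything is over a field $k$; Sweedler-type notation (summation suppressed) is used. Basic objects are pairs $(X,\alpha_X)$ of a $k$-vector space and a linear automorphism; morphisms are linear maps commuting with the automorphisms; $(X,\alpha_X)\otimes(Y,\alpha_Y)=(X\otimes Y,\alpha_X\otimes\alpha_Y)$, with associativity constraint $(x\otimes y)\otimes z\mapsto\alpha_X(x)\otimes(y\otimes\alpha_Z^{-1}(z))$ and unit object $(k,\mathrm{id})$. Involutive means that the structure automorphism squares to the identity. Monoidal Hom-algebra $(A,\beta)$: a pair with a multiplication and $1_A\in A$ such that $\beta(a)(bc)=(ab)\beta(c)$, $\beta(ab)=\beta(a)\beta(b)$, $a1_A=1_Aa=\beta(a)$, $\beta(1_A)=1_A$. Monoidal Hom-coalgebra $(C,\gamma)$: a pair with $\Delta(c)=c_1\otimes c_2$ and $\epsilon$ such that $\gamma^{-1}(c_1)\otimes\Delta(c_2)=\Delta(c_1)\otimes\gamma^{-1}(c_2)$, $\Delta(\gamma(c))=\gamma(c_1)\otimes\gamma(c_2)$,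 $c_1\epsilon(c_2)=\epsilon(c_1)c_2=\gamma^{-1}(c)$, $\epsilon(\gamma(c))=\epsilon(c)$. Monoidal Hom-Hopf algebra $(H,\alpha)$: both structures (with the same $\alpha$), $\Delta$ and $\epsilon$ multiplicative and unital, and an antipode $S$ with $S\alpha=\alpha S$, $S(h_1)h_2=\epsilon(h)1_H=h_1S(h_2)$. $S$ is assumed bijective. An object $(M,\mu)$ of ${}^{H}_{H}\mathcal{HYD}$ (left-left Hom-Yetter-Drinfeld module) is a pair with a left action satisfying $\alpha(h)\cdot(g\cdot m)=(hg)\cdot\mu(m)$, $1_H\cdot m=\mu(m)$, $\mu(h\cdot m)=\alpha(h)\cdot\mu(m)$, and a left coaction $\rho(m)=m_{(-1)}\otimes m_0\in H\otimes M$ satisfying $\Delta(m_{(-1)})\otimes\mu^{-1}(m_0)=\alpha^{-1}(m_{(-1)})\otimes(m_{0(-1)}\otimes m_{00})$, $\rho(\mu(m))=\alpha(m_{(-1)})\otimes\mu(m_0)$, $\epsilon(m_{(-1)})m_0=\mu^{-1}(m)$, and $\rho(h\cdot m)=(h_{11}\alpha^{-1}(m_{(-1)}))S(h_2)\otimes\alpha(h_{12})\cdot m_0$. Morphisms are $H$-linear, $H$-colinear maps commuting with the structure automorphisms. Tensor products carry $h\cdot(m\otimes n)=h_1\cdot m\otimes h_2\cdot n$ and $\rho(m\otimes n)=m_{(-1)}n_{(-1)}\otimes(m_0\otimes n_0)$. The braiding is $C_{M,N}(m\otimes n)=m_{(-1)}\cdot\nu^{-1}(n)\otimes\mu(m_0)$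 for $(M,\mu),(N,\nu)$. A monoidal Hom-algebra in ${}^{H}_{H}\mathcal{HYD}$ is an object $(A,\beta)$ that is a monoidal Hom-algebra with $h\cdot(ab)=(h_1\cdot a)(h_2\cdot b)$, $h\cdot1_A=\epsilon(h)1_A$, $\rho(ab)=a_{(-1)}b_{(-1)}\otimes a_0b_0$, $\rho(1_A)=1_H\otimes1_A$. A braided Hom-Lie algebra is a triple $(L,[\,,],\beta)$ where $(L,\beta)$ is an object of ${}^{H}_{H}\mathcal{HYD}$ and $[\,,]:L\otimes L\to L$ is a morphism in ${}^{H}_{H}\mathcal{HYD}$ with (i) $[l,l']=-[l_{(-1)}\cdot\beta^{-1}(l'),\beta(l_0)]$; (ii) $\{l\otimes l'\otimes l''\}+\{(C\otimes1)(1\otimes C)(l\otimes l'\otimes l'')\}+\{(1\otimes C)(C\otimes1)(l\otimes l'\otimes l'')\}=0$, where $\{l\otimes l'\otimes l''\}=[\beta(l),[l',l'']]$ and $C\otimes1,1\otimes C$ are linear maps on the vector space $L\otimes L\otimes L$. For a monoidal Hom-algebra $(A,\beta_A)$ in ${}^{H}_{H}\mathcal{HYD}$, $A^-$ denotes $A$ with bracket $[a,b]=ab-(a_{(-1)}\cdot\beta_A^{-1}(b))\beta_A(a_0)$. A morphism of Hom-Lie algebras in ${}^{H}_{H}\mathcal{HYD}$ is a morphism in ${}^{H}_{H}\mathcal{HYD}$ preserving brackets. A universal enveloping algebra of $L$ is a monoidal Hom-algebra $(U(L),m_U,\beta_U)$ in ${}^{H}_{H}\mathcal{HYD}$ together with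 a morphism $\psi:L\to U(L)$ of Hom-Lie algebras in ${}^{H}_{H}\mathcal{HYD}$ (into $U(L)^-$) such that for any monoidal Hom-algebra $(A,m_A,\beta_A)$ in ${}^{H}_{H}\mathcal{HYD}$ and any Hom-Lie algebra morphism $f:L\to A^-$ in ${}^{H}_{H}\mathcal{HYD}$ there is a unique morphism $g:U(L)\to A$ of monoidal Hom-algebras in ${}^{H}_{H}\mathcal{HYD}$ with $g\circ\psi=f$. For an involutive object $(M,\beta)$, $T(M)=\bigoplus_{i\geq0}M^{\otimes i}$, where $M^{\otimes0}=k$ and $M^{\otimes i}=M^{\otimes(i-1)}\otimes M$ as objects of ${}^{H}_{H}\mathcal{HYD}$ (with $k$ carrying the trivial action $\epsilon$ and coaction $1\mapsto 1_H\otimes1$); $\beta_T$ is $\beta^{\otimes i}$ on $M^{\otimes i}$ and the identity on $k$; the product is $(x_1\otimes\cdots\otimes x_i)\odot(y_1\otimes\cdots\otimes y_j)=\beta_T^{j-1}(x_1\otimes\cdots\otimes x_i)\otimes y_1\otimes\beta_T(y_2\otimes\cdots\otimes y_j)$ for $i,j\geq1$, and $1\odot x=x\odot1=\beta_T(x)$. Then $(T(M),\odot,\beta_T)$ is an involutive monoidal Hom-algebra in ${}^{H}_{H}\mathcal{HYD}$. An $H$-Hom-ideal $U$ of $A$ is a subspace with $H\cdot U\subseteq U$, $\rho(U)\subseteq H\otimes U$, $\beta(U)\subseteq U$, $(AU)A=A(UA)\subseteq U$; the one generated by a set is the smallest containing it. The automorphism of $U(L)=T(L)/I$ induced by $\beta_T$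 is again denoted $\beta_T$. *)

(* Defs.v *)
From HB Require Import structures.
From mathcomp Require Import all_boot all_order all_algebra.
From mathcomp Require Import boolp classical_sets fsbigop.

Set Implicit Arguments.
Unset Strict Implicit.
Unset Printing Implicit Defensive.

Import GRing.Theory.
Local Open Scope quotient_scope.
Local Open Scope classical_set_scope.
Local Open Scope ring_scope.

Definition is_bilinear (k : fieldType) (V W P : lmodType k)
  (f : V -> W -> P) : Prop :=
  (forall w, linear (f^~ w)) /\ (forall v, linear (f v)).

(* Tensor product of arbitrary vector spaces: a tensor is a finite formal sum *)
(* of pairs (v, w), and two formal sums are the same tensor when no bilinear  *)
(* map separates them.  Scalars and signs are absorbed in the first factor.   *)
Section Tensor.
Variables (k : fieldType) (V W : lmodType k).
Implicit Types s t : seq (V * W).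

Definition tensor_rel s t : bool :=
  `[< forall (P : lmodType k) (f : V -> W -> P), is_bilinear f ->
      \sum_(p <- s) f p.1 p.2 = \sum_(p <- t) f p.1 p.2 >].

Lemma tensor_rel_equiv : equiv_class_of tensor_rel.
Proof.
split=> [s|s t|t s u].
- by apply/asboolP.
- by apply/asboolP/asboolP => st P f /st.
- move=> /asboolP st /asboolP tu; apply/asboolP => P f bf.
  by rewrite (st _ _ bf) (tu _ _ bf).
Qed.

Canonical tensor_rel_equivRel := EquivRelPack tensor_rel_equiv.
Canonical tensor_rel_encModRel := defaultEncModRel tensor_rel.

Definition tensor := {eq_quot tensor_rel}.
HB.instance Definition _ := EqQuotient.on tensor.
HB.instance Definition _ := Choice.on tensor.

Implicit Types x y z : tensor.

(* Sweedler notation: the sum of the f v w over a chosen expression of x as a *)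
(* sum of pure tensors.  The choice is irrelevant as soon as f is bilinear.   *)
Definition sweedler (P : nmodType) x (f : V -> W -> P) : P :=
  \sum_(p <- repr x) f p.1 p.2.

Definition tpure (v : V) (w : W) : tensor := \pi_tensor [:: (v, w)].

Lemma sweedler_pi (P : lmodType k) (f : V -> W -> P) s : is_bilinear f ->
  sweedler (\pi_tensor s) f = \sum_(p <- s) f p.1 p.2.
Proof.
move=> bf; have /eqmodP/asboolP := reprK (\pi_tensor s).
by move=> /(_ P f bf).
Qed.

Lemma tensorP x y :
  (forall (P : lmodType k) (f : V -> W -> P), is_bilinear f ->
     sweedler x f = sweedler y f) <-> x = y.
Proof.
split=> [xy|-> //]; rewrite -[x]reprK -[y]reprK; apply/eqmodP/asboolP.
exact: xy.
Qed.

Definition tadd x y : tensor := \pi_tensor (repr x ++ repr y).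
Definition tscale (c : k) x : tensor :=
  \pi_tensor [seq (c *: p.1, p.2) | p <- repr x].
Definition tzero : tensor := \pi_tensor [::].

Section Ops.
Variables (P : lmodType k) (f : V -> W -> P).
Hypothesis bf : is_bilinear f.

Lemma sweedler_tadd x y : sweedler (tadd x y) f = sweedler x f + sweedler y f.
Proof. by rewrite sweedler_pi // big_cat. Qed.

Lemma bilinearZl c v w : f (c *: v) w = c *: f v w.
Proof. exact: (scalable_linear (bf.1 w)). Qed.

Lemma sweedler_tscale c x : sweedler (tscale c x) f = c *: sweedler x f.
Proof.
rewrite sweedler_pi // big_map scaler_sumr.
by apply: eq_bigr => p _; rewrite bilinearZl.
Qed.

Lemma sweedler_tzero : sweedler tzero f = 0.
Proof. by rewrite sweedler_pi // big_nil. Qed.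
End Ops.

Lemma taddA : associative tadd.
Proof.
by move=> x y z; apply/tensorP => P f bf; rewrite !sweedler_tadd // addrA.
Qed.

Lemma taddC : commutative tadd.
Proof.
by move=> x y; apply/tensorP => P f bf; rewrite !sweedler_tadd // addrC.
Qed.

Lemma tadd0 : left_id tzero tadd.
Proof.
move=> x; apply/tensorP => P f bf.
by rewrite sweedler_tadd // sweedler_tzero // add0r.
Qed.

Lemma taddN : left_inverse tzero (tscale (-1)) tadd.
Proof.
move=> x; apply/tensorP => P f bf.
rewrite sweedler_tadd // sweedler_tscale // sweedler_tzero //.
by rewrite scaleN1r addNr.
Qed.

HB.instance Definition _ := GRing.isZmodule.Build tensor taddA taddC tadd0 taddN.

Lemma tscaleA a b x : tscale a (tscale b x) = tscale (a * b) x.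
Proof.
by apply/tensorP => P f bf; rewrite !sweedler_tscale // scalerA.
Qed.

Lemma tscale1 : left_id 1 tscale.
Proof. by move=> x; apply/tensorP => P f bf; rewrite sweedler_tscale // scale1r. Qed.

Lemma tscaleDr : right_distributive tscale +%R.
Proof.
move=> c x y; apply/tensorP => P f bf.
by rewrite sweedler_tscale // !sweedler_tadd // !sweedler_tscale // scalerDr.
Qed.

Lemma tscaleDl x : {morph tscale^~ x : a b / a + b}.
Proof.
move=> a b; apply/tensorP => P f bf.
by rewrite sweedler_tscale // sweedler_tadd // !sweedler_tscale // scalerDl.
Qed.

HB.instance Definition _ := GRing.Zmodule_isLmodule.Build k tensor
  tscaleA tscale1 tscaleDr tscaleDl.

Lemma sweedler_linear (P : lmodType k) (f : V -> W -> P) :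
  is_bilinear f -> linear (fun x => sweedler x f).
Proof.
move=> bf c x y.
have -> : c *: x + y = tadd (tscale c x) y by [].
by rewrite sweedler_tadd // sweedler_tscale.
Qed.

Lemma sweedler_pure (P : lmodType k) (f : V -> W -> P) v w :
  is_bilinear f -> sweedler (tpure v w) f = f v w.
Proof. by move=> bf; rewrite sweedler_pi // big_seq1. Qed.

Lemma tpure_bilinear : is_bilinear tpure.
Proof.
split=> [w c v v' | v c w w']; apply/tensorP => P f bf.
  rewrite (sweedler_linear bf) !sweedler_pure //; exact: (bf.1 w).
rewrite (sweedler_linear bf) !sweedler_pure //; exact: (bf.2 v).
Qed.

Lemma sweedler_id x : sweedler x tpure = x.
Proof.
apply/tensorP => P f bf.
have E (s : seq (V * W)) :
  sweedler (\sum_(p <- s) tpure p.1 p.2) f = \sum_(p <- s) f p.1 p.2.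
  elim: s => [|p s IH]; first by rewrite !big_nil sweedler_tzero.
  by rewrite !big_cons -IH sweedler_tadd // sweedler_pure.
by rewrite /sweedler -/(sweedler _ f) E.
Qed.

End Tensor.

Notation "v ⊗ w" := (tpure v w) (at level 40, left associativity) : ring_scope.
Reserved Notation "\sw_ ( a ⊗ b <- x ) F"
  (at level 41, a name, b name, x at level 200, F at level 41,
   format "\sw_ ( a  ⊗  b  <-  x )  F").
Notation "\sw_ ( a ⊗ b <- x ) F" := (sweedler x (fun a b => F)) : ring_scope.

Section DirectSum.
Variables (k : fieldType) (V : nat -> lmodType k).

Record dsum : Type := DSum {
  dcoef :> forall i, V i;
  dsum_finite : exists n : nat, forall i, (n <= i)%N -> dcoef i = 0 }.

HB.instance Definition _ := gen_eqMixin dsum.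
HB.instance Definition _ := gen_choiceMixin dsum.

Lemma dsumP (x y : dsum) : (forall i, x i = y i) <-> x = y.
Proof.
split=> [|-> //]; case: x y => [x fx] [y fy] /= exy.
have xy := functional_extensionality_dep exy.
by case: _ / xy fy => fy; congr DSum; exact: Prop_irrelevance.
Qed.

Lemma dadd_finite (x y : dsum) :
  exists n : nat, forall i, (n <= i)%N -> x i + y i = 0.
Proof.
have [[m xm] [n yn]] := (dsum_finite x, dsum_finite y).
exists (maxn m n) => i; rewrite geq_max => /andP[mi ni].
by rewrite xm // yn // addr0.
Qed.

Lemma dscale_finite c (x : dsum) :
  exists n : nat, forall i, (n <= i)%N -> c *: x i = 0.
Proof.
by have [n xn] := dsum_finite x; exists n => i ni; rewrite xn // scaler0.
Qed.

Definition dzero : dsum := DSum (ex_intro _ 0%N (fun i _ => erefl (0 : V i))).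
Definition dadd (x y : dsum) : dsum := DSum (dadd_finite x y).
Definition dscale (c : k) (x : dsum) : dsum := DSum (dscale_finite c x).

Lemma daddA : associative dadd.
Proof. by move=> x y z; apply/dsumP => i /=; rewrite addrA. Qed.
Lemma daddC : commutative dadd.
Proof. by move=> x y; apply/dsumP => i /=; rewrite addrC. Qed.
Lemma dadd0 : left_id dzero dadd.
Proof. by move=> x; apply/dsumP => i /=; rewrite add0r. Qed.
Lemma daddN : left_inverse dzero (dscale (-1)) dadd.
Proof. by move=> x; apply/dsumP => i /=; rewrite scaleN1r addNr. Qed.

HB.instance Definition _ := GRing.isZmodule.Build dsum daddA daddC dadd0 daddN.

Lemma dscaleA a b x : dscale a (dscale b x) = dscale (a * b) x.
Proof. by apply/dsumP => i /=; rewrite scalerA. Qed.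
Lemma dscale1 : left_id 1 dscale.
Proof. by move=> x; apply/dsumP => i /=; rewrite scale1r. Qed.
Lemma dscaleDr : right_distributive dscale +%R.
Proof. by move=> c x y; apply/dsumP => i /=; rewrite scalerDr. Qed.
Lemma dscaleDl x : {morph dscale^~ x : a b / a + b}.
Proof. by move=> a b; apply/dsumP => i /=; rewrite scalerDl. Qed.

HB.instance Definition _ := GRing.Zmodule_isLmodule.Build k dsum
  dscaleA dscale1 dscaleDr dscaleDl.

Lemma dinj_finite i (x : V i) :
  exists n : nat, forall j, (n <= j)%N -> dfwith (fun j => 0 : V j) x j = 0.
Proof.
by exists i.+1 => j ij; rewrite dfwith_out // neq_ltn ij.
Qed.

Definition dinj i (x : V i) : dsum := DSum (dinj_finite x).

End DirectSum.

Arguments dinj {k} V i x.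

Definition subspace (k : fieldType) (V : lmodType k) (U : set V) : Prop :=
  U 0 /\ forall c x y, U x -> U y -> U (c *: x + y).

Definition lspan (k : fieldType) (V : lmodType k) (S : set V) : set V :=
  smallest (@subspace k V) S.

Section LinearQuotient.
Variables (k : fieldType) (V : lmodType k).

Definition subspace_pred (U : set V) (hU : subspace U) : {pred V} :=
  fun x => `[< U x >].

Lemma subspace_pred_closed U (hU : subspace U) : submod_closed (subspace_pred hU).
Proof.
split=> [|c x y /asboolP Ux /asboolP Uy]; apply/asboolP; first exact: hU.1.
exact: hU.2.
Qed.

HB.instance Definition _ U (hU : subspace U) :=
  GRing.isSubmodClosed.Build k V (subspace_pred hU) (subspace_pred_closed hU).

Variables (U : set V) (hU : subspace U).

Definition lquot : Type := Quotient.quot (subspace_pred hU).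

HB.instance Definition _ := GRing.Zmodule.on lquot.
HB.instance Definition _ := EqQuotient.on lquot.

Lemma lquotP (x y : V) : \pi_lquot x = \pi_lquot y <-> U (x - y).
Proof.
split=> [/eqP|Uxy]; first by rewrite -Quotient.idealrBE => /asboolP.
by apply/eqP; rewrite -Quotient.idealrBE; apply/asboolP.
Qed.

Definition lquot_scale (c : k) (x : lquot) : lquot := \pi_lquot (c *: repr x).

Lemma lquot_scale_pi c x : lquot_scale c (\pi_lquot x) = \pi_lquot (c *: x).
Proof.
apply/lquotP; rewrite -scalerBr.
have /lquotP Ux := reprK (\pi_lquot x).
by have := hU.2 c _ _ Ux hU.1; rewrite addr0.
Qed.

Lemma lquot_piD x y : \pi_lquot x + \pi_lquot y = \pi_lquot (x + y).
Proof. by rewrite -(raddfD (\pi_(Quotient.quot (subspace_pred hU)))). Qed.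

Lemma lquot_scaleA a b x :
  lquot_scale a (lquot_scale b x) = lquot_scale (a * b) x.
Proof.
rewrite -[x]reprK (lquot_scale_pi b) (lquot_scale_pi a) lquot_scale_pi.
by rewrite scalerA.
Qed.

Lemma lquot_scale1 : left_id 1 lquot_scale.
Proof. by move=> x; rewrite -[x]reprK lquot_scale_pi scale1r. Qed.

Lemma lquot_scaleDr : right_distributive lquot_scale +%R.
Proof.
move=> c x y; rewrite -[x]reprK -[y]reprK lquot_piD !lquot_scale_pi.
by rewrite scalerDr -lquot_piD.
Qed.

Lemma lquot_scaleDl x : {morph lquot_scale^~ x : a b / a + b}.
Proof.
by move=> a b; rewrite -[x]reprK !lquot_scale_pi scalerDl -lquot_piD.
Qed.

HB.instance Definition _ := GRing.Zmodule_isLmodule.Build k lquot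
  lquot_scaleA lquot_scale1 lquot_scaleDr lquot_scaleDl.

End LinearQuotient.

(* Structures are split into raw operations (records) and their axioms        *)
(* (predicates).  The operations use chosen Sweedler expressions and chosen   *)
(* representatives, which become irrelevant once the axioms hold.             *)

Record homObj (k : fieldType) := HomObj {
  ho_sort :> lmodType k;
  aut : ho_sort -> ho_sort }.

Definition hom_object (k : fieldType) (X : homObj k) : Prop :=
  linear (@aut k X) /\ bijective (@aut k X).

Definition iaut (k : fieldType) (X : homObj k) (x : X) : X :=
  xget 0 [set y | aut y = x].

Definition involutive_object (k : fieldType) (X : homObj k) : Prop :=
  involutive (@aut k X).

Definition hom_tensor (k : fieldType) (X Y : homObj k) : homObj k :=
  @HomObj k (tensor X Y) (fun t => \sw_(x ⊗ y <- t) (aut x ⊗ aut y)).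

Record hom_algebra (k : fieldType) (A : homObj k) (mul : A -> A -> A) (one : A)
  : Prop := {
  hom_mul_bilinear : is_bilinear mul;
  hom_mulA : forall a b c, mul (aut a) (mul b c) = mul (mul a b) (aut c);
  hom_aut_mul : forall a b, aut (mul a b) = mul (aut a) (aut b);
  hom_mul1r : forall a, mul a one = aut a;
  hom_mul1l : forall a, mul one a = aut a;
  hom_aut_one : aut one = one }.

Record hom_coalgebra (k : fieldType) (C : homObj k)
  (comul : C -> tensor C C) (counit : C -> k) : Prop := {
  hom_comul_linear : linear comul;
  hom_counit_linear : scalar counit;
  (* both sides live in C ⊗ (C ⊗ C) *)
  hom_coassoc : forall c,
    \sw_(c1 ⊗ c2 <- comul c) (iaut c1 ⊗ comul c2) =
    \sw_(c1 ⊗ c2 <- comul c) \sw_(c11 ⊗ c12 <- comul c1)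
      (c11 ⊗ (c12 ⊗ iaut c2));
  hom_comul_aut : forall c,
    comul (aut c) = \sw_(c1 ⊗ c2 <- comul c) (aut c1 ⊗ aut c2);
  hom_counitr : forall c,
    \sw_(c1 ⊗ c2 <- comul c) (counit c2 *: c1) = iaut c;
  hom_counitl : forall c,
    \sw_(c1 ⊗ c2 <- comul c) (counit c1 *: c2) = iaut c;
  hom_counit_aut : forall c, counit (aut c) = counit c }.

Record homHopf (k : fieldType) := HomHopf {
  hh_obj :> homObj k;
  hmul : hh_obj -> hh_obj -> hh_obj;
  hone : hh_obj;
  comul : hh_obj -> tensor hh_obj hh_obj;
  counit : hh_obj -> k;
  antipode : hh_obj -> hh_obj }.

Arguments hone {k h}.

Record hom_hopf_algebra (k : fieldType) (H : homHopf k) : Prop := {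
  hopf_object : hom_object H;
  hopf_algebra : hom_algebra (@hmul k H) hone;
  hopf_coalgebra : hom_coalgebra (@comul k H) (@counit k H);
  hopf_comul_mul : forall g h : H, comul (hmul g h) =
    \sw_(g1 ⊗ g2 <- comul g) \sw_(h1 ⊗ h2 <- comul h)
      (hmul g1 h1 ⊗ hmul g2 h2);
  hopf_comul_one : comul (hone : H) = hone ⊗ hone;
  hopf_counit_mul : forall g h : H, counit (hmul g h) = counit g * counit h;
  hopf_counit_one : counit (hone : H) = 1;
  hopf_antipode_linear : linear (@antipode k H);
  hopf_antipode_aut : forall h : H, antipode (aut h) = aut (antipode h);
  hopf_antipodel : forall h : H,
    \sw_(h1 ⊗ h2 <- comul h) hmul (antipode h1) h2 = counit h *: hone;
  hopf_antipoder : forall h : H,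
    \sw_(h1 ⊗ h2 <- comul h) hmul h1 (antipode h2) = counit h *: hone;
  hopf_antipode_bijective : bijective (@antipode k H) }.

Record hyd (k : fieldType) (H : homHopf k) := Hyd {
  hyd_obj :> homObj k;
  act : H -> hyd_obj -> hyd_obj;
  coact : hyd_obj -> tensor H hyd_obj }.

Arguments Hyd {k} H hyd_obj act coact.

Record hyd_module (k : fieldType) (H : homHopf k) (M : hyd H) : Prop := {
  hyd_object : hom_object M;
  hyd_act_bilinear : is_bilinear (@act k H M);
  hyd_coact_linear : linear (@coact k H M);
  hyd_actA : forall (h g : H) (m : M),
    act (aut h) (act g m) = act (hmul h g) (aut m);
  hyd_act1 : forall m : M, act (hone : H) m = aut m;
  hyd_aut_act : forall (h : H) (m : M), aut (act h m) = act (aut h) (aut m);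
  (* both sides live in H ⊗ (H ⊗ M) *)
  hyd_coactA : forall m : M,
    \sw_(a ⊗ m0 <- coact m) \sw_(a1 ⊗ a2 <- comul a)
      (a1 ⊗ (a2 ⊗ iaut m0)) =
    \sw_(a ⊗ m0 <- coact m) (iaut a ⊗ coact m0);
  hyd_coact_aut : forall m : M,
    coact (aut m) = \sw_(a ⊗ m0 <- coact m) (aut a ⊗ aut m0);
  hyd_counit : forall m : M,
    \sw_(a ⊗ m0 <- coact m) (counit a *: m0) = iaut m;
  hyd_compat : forall (h : H) (m : M), coact (act h m) =
    \sw_(h1 ⊗ h2 <- comul h) \sw_(h11 ⊗ h12 <- comul h1)
      \sw_(a ⊗ m0 <- coact m)
        (hmul (hmul h11 (iaut a)) (antipode h2) ⊗ act (aut h12) m0) }.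

Record hyd_morphism (k : fieldType) (H : homHopf k) (M N : hyd H)
  (f : M -> N) : Prop := {
  hmor_linear : linear f;
  hmor_act : forall (h : H) (m : M), f (act h m) = act h (f m);
  hmor_coact : forall m : M,
    coact (f m) = \sw_(a ⊗ m0 <- coact m) (a ⊗ f m0);
  hmor_aut : forall m : M, f (aut m) = aut (f m) }.

Definition hyd_unit (k : fieldType) (H : homHopf k) : hyd H :=
  Hyd H (@HomObj k k^o id) (fun h c => counit h *: c)
    (fun c => (c : k) *: ((hone : H) ⊗ (1 : k^o))).

Definition hyd_tensor (k : fieldType) (H : homHopf k) (M N : hyd H) : hyd H :=
  Hyd H (hom_tensor M N)
    (fun h t => \sw_(h1 ⊗ h2 <- comul h) \sw_(m ⊗ n <- t)
       (act h1 m ⊗ act h2 n))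
    (fun t => \sw_(m ⊗ n <- t) \sw_(a ⊗ m0 <- coact m) \sw_(b ⊗ n0 <- coact n)
       (hmul a b ⊗ (m0 ⊗ n0))).

Definition braiding (k : fieldType) (H : homHopf k) (M N : hyd H)
  (t : tensor M N) : tensor N M :=
  \sw_(m ⊗ n <- t) \sw_(a ⊗ m0 <- coact m) (act a (iaut n) ⊗ aut m0).

Record hydAlg (k : fieldType) (H : homHopf k) := HydAlg {
  ha_hyd :> hyd H;
  amul : ha_hyd -> ha_hyd -> ha_hyd;
  aone : ha_hyd }.

Arguments aone {k H h}.
Arguments HydAlg {k H} ha_hyd amul aone.

Record hyd_algebra (k : fieldType) (H : homHopf k) (A : hydAlg H) : Prop := {
  halg_module : hyd_module A;
  halg_algebra : hom_algebra (@amul k H A) aone;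
  halg_act_mul : forall (h : H) (a b : A), act h (amul a b) =
    \sw_(h1 ⊗ h2 <- comul h) amul (act h1 a) (act h2 b);
  halg_act_one : forall h : H, act h (aone : A) = counit h *: aone;
  halg_coact_mul : forall a b : A, coact (amul a b) =
    \sw_(a' ⊗ a0 <- coact a) \sw_(b' ⊗ b0 <- coact b)
      (hmul a' b' ⊗ amul a0 b0);
  halg_coact_one : coact (aone : A) = hone ⊗ aone }.

Record hyd_algebra_morphism (k : fieldType) (H : homHopf k) (A B : hydAlg H)
  (g : A -> B) : Prop := {
  amor_hyd : hyd_morphism g;
  amor_mul : forall a b : A, g (amul a b) = amul (g a) (g b);
  amor_one : g aone = aone }.

Record homLie (k : fieldType) (H : homHopf k) := HomLie {
  hl_hyd :> hyd H;
  bracket : hl_hyd -> hl_hyd -> hl_hyd }.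

Arguments HomLie {k H} hl_hyd bracket.

Section BraidedHomLie.
Variables (k : fieldType) (H : homHopf k) (L : homLie H).

(* L ⊗ L ⊗ L is represented as L ⊗ (L ⊗ L), without any twist by aut. *)
Definition braid12 (t : tensor L (tensor L L)) : tensor L (tensor L L) :=
  \sw_(x ⊗ u <- t) \sw_(y ⊗ z <- u) \sw_(y' ⊗ x' <- braiding (x ⊗ y))
    (y' ⊗ (x' ⊗ z)).

Definition braid23 (t : tensor L (tensor L L)) : tensor L (tensor L L) :=
  \sw_(x ⊗ u <- t) (x ⊗ braiding u).

Definition triple_bracket (t : tensor L (tensor L L)) : L :=
  \sw_(x ⊗ u <- t) \sw_(y ⊗ z <- u) bracket (aut x) (bracket y z).

Record braided_hom_lie : Prop := {
  bhl_module : hyd_module L;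
  bhl_bilinear : is_bilinear (@bracket k H L);
  bhl_morphism : @hyd_morphism k H (hyd_tensor L L) L
    (fun t => \sw_(x ⊗ y <- t) bracket x y);
  bhl_skew : forall x y : L, bracket x y =
    - \sw_(a ⊗ x0 <- coact x) bracket (act a (iaut y)) (aut x0);
  bhl_jacobi : forall x y z : L,
    triple_bracket (x ⊗ (y ⊗ z))
    + triple_bracket (braid12 (braid23 (x ⊗ (y ⊗ z))))
    + triple_bracket (braid23 (braid12 (x ⊗ (y ⊗ z)))) = 0 }.
End BraidedHomLie.

Record hom_lie_morphism (k : fieldType) (H : homHopf k) (L L' : homLie H)
  (f : L -> L') : Prop := {
  lmor_hyd : hyd_morphism f;
  lmor_bracket : forall x y : L, f (bracket x y) = bracket (f x) (f y) }.

Definition minus_alg (k : fieldType) (H : homHopf k) (A : hydAlg H) : homLie H :=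
  HomLie A (fun a b : A => amul a b -
    \sw_(h ⊗ a0 <- coact a) amul (act h (iaut b)) (aut a0)).

Definition universal_enveloping (k : fieldType) (H : homHopf k) (L : homLie H)
  (U : hydAlg H) (psi : L -> U) : Prop :=
  [/\ hyd_algebra U,
      @hom_lie_morphism k H L (minus_alg U) psi
    & forall A : hydAlg H, hyd_algebra A ->
      forall f : L -> A, @hom_lie_morphism k H L (minus_alg A) f ->
      exists! g : U -> A, hyd_algebra_morphism g /\ g \o psi = f].

Section HomIdeal.
Variables (k : fieldType) (H : homHopf k) (A : hydAlg H).

(* The span of the products x y with x in U and y in W. *)
Definition mul_span (U W : set A) : set A :=
  lspan [set z | exists x y, [/\ U x, W y & z = amul x y]].

(* H ⊗ U as a subspace of H ⊗ A. *)
Definition tensor_sub (U : set A) : set (tensor H A) :=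
  lspan [set z | exists (h : H) (u : A), U u /\ z = h ⊗ u].

Record hom_ideal (U : set A) : Prop := {
  ideal_subspace : subspace U;
  ideal_act : forall (h : H) (u : A), U u -> U (act h u);
  ideal_coact : forall u : A, U u -> tensor_sub U (coact u);
  ideal_aut : forall u : A, U u -> U (aut u);
  ideal_mulA : mul_span (mul_span setT U) setT = mul_span setT (mul_span U setT);
  ideal_mul : mul_span (mul_span setT U) setT `<=` U }.

Definition ideal_gen (S : set A) : set A := smallest hom_ideal S.

Lemma ideal_gen_subspace S : subspace (ideal_gen S).
Proof.
split=> [|c x y Ux Uy] U US; first by case: US => /ideal_subspace[].
by have /ideal_subspace[_] := US.1; apply; [apply: Ux | apply: Uy].
Qed.
End HomIdeal.

Section TensorAlgebra.
Variables (k : fieldType) (H : homHopf k) (M : hyd H).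

(* The first power is M itself and not k ⊗ M: the natural identification of   *)
(* the latter with M is c ⊗ m |-> c *: aut m.                                 *)
Fixpoint tpow (i : nat) : hyd H :=
  match i with
  | 0 => hyd_unit H
  | i'.+1 => if i' is _.+1 then hyd_tensor (tpow i') M else M
  end.

Definition talg : lmodType k := dsum (fun i => tpow i).

Definition tinj (i : nat) (x : tpow i) : talg := dinj (fun i => tpow i) i x.

Definition talg_obj : homObj k :=
  @HomObj k talg (fun t => \sum_(i \in [set: nat]) tinj (aut (t i))).

Definition talg_hyd : hyd H :=
  Hyd H talg_obj
    (fun h t => \sum_(i \in [set: nat]) tinj (act h (t i)))
    (fun t => \sum_(i \in [set: nat])
       \sw_(a ⊗ x <- coact (t i)) (a ⊗ (tinj x : talg_obj))).

(* Plain concatenation of x_1 ⊗ ... ⊗ x_(i+1) and y_1 ⊗ ... ⊗ y_(j+1). *)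
Fixpoint tcat (i j : nat) (x : tpow i.+1) :
    tpow j.+1 -> tpow (j + i).+2 :=
  match j return tpow j.+1 -> tpow (j + i).+2 with
  | 0 => fun y => (x ⊗ (y : M) : tensor (tpow i.+1) M)
  | j'.+1 => fun y : tensor (tpow j'.+1) M =>
      \sw_(y' ⊗ m <- y) ((tcat x y' ⊗ m) : tensor (tpow (j' + i).+2) M)
  end.

(* y_1 ⊗ ... ⊗ y_(j+1) |-> y_1 ⊗ aut (y_2 ⊗ ... ⊗ y_(j+1)) *)
Fixpoint aut_tail (j : nat) : tpow j.+1 -> tpow j.+1 :=
  match j return tpow j.+1 -> tpow j.+1 with
  | 0 => id
  | j'.+1 => fun y : tensor (tpow j'.+1) M =>
      \sw_(y' ⊗ m <- y) ((aut_tail y' ⊗ aut m) : tensor (tpow j'.+1) M)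
  end.

(* Degree 0 consists of scalars; for x of degree i'.+1 and y of degree j'.+1  *)
(* the twist of x is aut ^ (j'.+1 - 1).                                       *)
Definition tmul_hom (i j : nat) : tpow i -> tpow j -> talg :=
  match i, j return tpow i -> tpow j -> talg with
  | 0, j => fun (c : k) y => tinj (c *: aut y)
  | i'.+1, 0 => fun x (c : k) => tinj (c *: aut x)
  | i'.+1, j'.+1 => fun x y => tinj (tcat (iter j' (@aut k _) x) (aut_tail y))
  end.

Definition tensor_alg : hydAlg H :=
  HydAlg talg_hyd
    (fun s t : talg => \sum_(i \in [set: nat]) \sum_(j \in [set: nat])
       tmul_hom (s i) (t j))
    (@tinj 0 (1 : k)).

End TensorAlgebra.

Section QuotientAlgebra.
Variables (k : fieldType) (H : homHopf k) (A : hydAlg H).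
Variables (U : set A) (hU : subspace U).

Local Notation Q := (lquot hU).

Definition quot_hyd : hyd H :=
  Hyd H (@HomObj k Q (fun x => \pi_Q (aut (repr x))))
    (fun h x => \pi_Q (act h (repr x)))
    (fun x => \sw_(a ⊗ y <- coact (repr x)) (a ⊗ \pi_Q y)).

Definition quot_alg : hydAlg H :=
  HydAlg quot_hyd (fun x y : Q => \pi_Q (amul (repr x) (repr y))) (\pi_Q aone).

End QuotientAlgebra.

Section EnvelopingAlgebra.
Variables (k : fieldType) (H : homHopf k) (L : homLie H).

Definition env_relations : set (tensor_alg L) :=
  [set t | exists x y : L, t =
    @tinj k H L 2 (x ⊗ y)
    - @tinj k H L 2 (\sw_(a ⊗ x0 <- coact x) (act a (aut y) ⊗ aut x0))
    - @tinj k H L 1 (bracket x y)].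

Definition env_ideal : set (tensor_alg L) := ideal_gen env_relations.

Lemma env_ideal_subspace : subspace env_ideal.
Proof. exact: ideal_gen_subspace. Qed.

Definition env_alg : hydAlg H := quot_alg env_ideal_subspace.

Definition env_incl (x : L) : env_alg :=
  \pi_(lquot env_ideal_subspace) (@tinj k H L 1 x).

End EnvelopingAlgebra.

(* Main.v *)
Require Import Defs.
From mathcomp Require Import all_boot all_order all_algebra.
From mathcomp Require Import boolp classical_sets fsbigop.

(* Since β is an involution, T(L) is generated by L under right               *)
(* multiplication by elements of degree one: the product is determined by     *)
(*   a (b m) = (β(a) b) β(m)     for m of degree one,                         *)
(* and every identity in T(L) follows by induction along t |-> t m.  That the *)
(* tensor powers are Yetter-Drinfeld modules reduces to the classical         *)
(* computation once H is untwisted: a * b = α(ab) and δ(h) = Δ(α(h)) form an  *)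
(* ordinary Hopf algebra.  A map f : L -> A extends to T(L) by                *)
(* x ⊗ m |-> F(x) f(m); its kernel is an H-Hom-ideal, because a subspace of   *)
(* the form H ⊗ U is cut out by contracting H with linear functionals.  The   *)
(* same criterion shows that H-Hom-ideals are closed under intersection.      *)

Set Implicit Arguments.
Unset Strict Implicit.
Unset Printing Implicit Defensive.

Import GRing.Theory.
Local Open Scope quotient_scope.
Local Open Scope classical_set_scope.
Local Open Scope ring_scope.

(** * Sweedler sums *)

(** Write β for every structure automorphism. On [H] and [L] it is an involution, hence also on
    T(L). The argument has three ingredients.

    T(L) is a Hom-algebra in the category. Its homogeneous parts are Yetter-Drinfeld modules by
    [tensor_module], whose core is the cancellation [cop_conj] in [H], and [talg_module] passes to
    the direct sum. Right multiplication by m of degree one is x |-> x ⊗ m in positive degree, while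
    1 m = β(m). The product obeys the recursion a (b m) = (β(a) b) β(m) ([talg_mulA1]), which is
    Hom-associativity rewritten with β^2 = 1. Every element arises from 1 by linear combinations and
    right multiplications ([talg_ind]), so each axiom is checked at 1 and along t |-> t m; this
    gives [tensor_alg_algebra].

    The ideal I behaves well. I is an intersection of H-Hom-ideals, and the delicate point is ρ(I) ⊆
    H ⊗ I. Over a field, z lies in H ⊗ U exactly when (φ ⊗ 1)(z) lies in U for every linear
    functional φ on H ([tensor_subspaceP]), and this criterion is stable under intersections
    ([hom_ideal_gen]). With β^2 = 1 an H-Hom-ideal is two-sided in the usual sense, so all
    operations descend to U(L) ([quot_algebra]). Read as products, the generators of I are the
    differences between the commutator and the bracket of elements of L, so ψ preserves brackets.

    The universal property. A morphism f : L -> A extends to F on T(L) by F(x ⊗ m) = F(x) f(m), and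
    the same recursion, now in A, makes F multiplicative ([talg_lift_morphism]). F kills the
    generators of I because f preserves brackets; its kernel is an H-Hom-ideal by the contraction
    criterion ([hom_ideal_ker]), so it contains I and F factors through U(L). For uniqueness, two
    morphisms that agree on ψ(L) agree after composition with π by [talg_ind], and π is onto. *)

Section LinearClosure.
Variable k : fieldType.
Implicit Types U V W X P : lmodType k.

Lemma linear_id_fun V : linear (fun x : V => x).
Proof. by []. Qed.

Lemma linear_add V W (f g : V -> W) :
  linear f -> linear g -> linear (fun x => f x + g x).
Proof. by move=> lf lg c x y; rewrite lf lg scalerDr addrACA. Qed.

Lemma linear_opp V W (f : V -> W) : linear f -> linear (fun x => - f x).
Proof. by move=> lf c x y; rewrite lf opprD scalerN. Qed.

Lemma linear_zero V W : linear (fun _ : V => 0 : W).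
Proof. by move=> c x y; rewrite scaler0 addr0. Qed.

Lemma linear_scale V W c (f : V -> W) : linear f -> linear (fun x => c *: f x).
Proof. by move=> lf d x y; rewrite lf scalerDr !scalerA mulrC. Qed.

Lemma linear_scalel V W (f : V -> k) (w : W) :
  scalar f -> linear (fun x => f x *: w).
Proof. by move=> lf d x y; rewrite lf scalerDl scalerA. Qed.

Lemma linear_compose U V W (g : V -> W) (f : U -> V) :
  linear g -> linear f -> linear (fun x => g (f x)).
Proof. by move=> lg lf c x y; rewrite lf lg. Qed.

Lemma scalar_compose U V (g : V -> k) (f : U -> V) :
  scalar g -> linear f -> scalar (fun x => g (f x)).
Proof. by move=> lg lf c x y; rewrite lf lg. Qed.

Lemma linear_bil1 U V W P (g : V -> W -> P) (f : U -> V) w :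
  is_bilinear g -> linear f -> linear (fun x => g (f x) w).
Proof. by move=> [lg _] lf c x y; rewrite lf (lg w). Qed.

Lemma linear_bil2 U V W P (g : V -> W -> P) v (f : U -> W) :
  is_bilinear g -> linear f -> linear (fun x => g v (f x)).
Proof. by move=> [_ lg] lf c x y; rewrite lf (lg v). Qed.

Lemma bilinear_linear V W P (g : V -> W -> P) v : is_bilinear g -> linear (g v).
Proof. by case. Qed.

Lemma linear_tri1 U V W X P (g : V -> W -> X -> P) (f : U -> V) w x :
  (forall x, is_bilinear (fun v w => g v w x)) -> linear f ->
  linear (fun u => g (f u) w x).
Proof. by move=> /(_ x)[lg _] lf c u v; rewrite lf (lg w). Qed.

Lemma linear_sw_arg U V W P (f : U -> tensor V W) (F : V -> W -> P) :
  is_bilinear F -> linear f -> linear (fun x => sweedler (f x) F).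
Proof. by move=> bF lf c x y; rewrite lf (sweedler_linear bF). Qed.

Lemma linear_sw_body U V W P (t : tensor V W) (F : U -> V -> W -> P) :
  (forall v w, linear (fun x => F x v w)) -> linear (fun x => sweedler t (F x)).
Proof.
move=> lF c x y; rewrite /sweedler scaler_sumr -big_split.
by apply: eq_bigr => p _; rewrite lF.
Qed.

Lemma linear_sub0 V W (f : V -> W) : linear f -> f 0 = 0.
Proof. by move=> lf; have := lf (-1) 0 0; rewrite scaler0 addr0 scaleN1r addNr. Qed.

Lemma linearD_fun V W (f : V -> W) : linear f -> {morph f : x y / x + y}.
Proof. by move=> lf x y; have := lf 1 x y; rewrite !scale1r. Qed.

Lemma linearZ_fun V W (f : V -> W) c x : linear f -> f (c *: x) = c *: f x.
Proof. by move=> lf; have := lf c x 0; rewrite !addr0 (linear_sub0 lf) addr0. Qed.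

Lemma linearB_fun V W (f : V -> W) : linear f -> {morph f : x y / x - y}.
Proof.
by move=> lf x y; rewrite linearD_fun // -!scaleN1r (linearZ_fun _ _ lf).
Qed.

Lemma subspace_ker V W (f : V -> W) : linear f -> subspace [set v | f v = 0].
Proof.
move=> lf; split=> [|c x y /= fx fy]; first exact: linear_sub0.
by rewrite /= lf fx fy scaler0 addr0.
Qed.

Lemma linear_sum_fun V W (f : V -> W) I (r : seq I) (Q : pred I) (F : I -> V) :
  linear f -> f (\sum_(i <- r | Q i) F i) = \sum_(i <- r | Q i) f (F i).
Proof.
move=> lf; apply: (big_morph f (linearD_fun lf)); exact: linear_sub0.
Qed.

Lemma linear_sweedler V W P U (f : P -> U) (t : tensor V W) (F : V -> W -> P) :
  linear f -> f (sweedler t F) = \sw_(a ⊗ b <- t) f (F a b).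
Proof. by move=> lf; rewrite /sweedler linear_sum_fun. Qed.

Lemma scale_sw V W P c (t : tensor V W) (F : V -> W -> P) :
  c *: sweedler t F = \sw_(a ⊗ b <- t) (c *: F a b).
Proof. exact: scaler_sumr. Qed.

Lemma eq_sw V W (P : nmodType) (t : tensor V W) (F G : V -> W -> P) :
  (forall a b, F a b = G a b) -> sweedler t F = sweedler t G.
Proof. by move=> FG; apply: eq_bigr => p _; apply: FG. Qed.

Lemma exchange_sw U V V' W' (P : nmodType) (t : tensor U V) (s : tensor V' W')
  (F : U -> V -> V' -> W' -> P) :
  \sw_(a ⊗ b <- t) \sw_(c ⊗ d <- s) F a b c d =
  \sw_(c ⊗ d <- s) \sw_(a ⊗ b <- t) F a b c d.
Proof. exact: exchange_big. Qed.

Lemma sw_sw U V V' W' P (t : tensor U V) (G : U -> V -> tensor V' W')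
  (F : V' -> W' -> P) : is_bilinear F ->
  sweedler (sweedler t G) F = \sw_(a ⊗ b <- t) sweedler (G a b) F.
Proof. by move=> bF; exact: (linear_sweedler _ _ (sweedler_linear bF)). Qed.

Lemma eq_tensor_linear V W P (f g : tensor V W -> P) : linear f -> linear g ->
  (forall v w, f (v ⊗ w) = g (v ⊗ w)) -> f =1 g.
Proof.
move=> lf lg fg t; rewrite -[t]sweedler_id !linear_sweedler //.
exact: eq_sw.
Qed.

(** Inductions over T(L) prove identities that are quantified over a second argument; the parameter
    [i] carries it. *)
Lemma subspace_eq I V P (f g : I -> V -> P) :
  (forall i, linear (f i)) -> (forall i, linear (g i)) ->
  subspace [set v | forall i, f i v = g i v].
Proof.
move=> lf lg; split=> [i|c x y /= fx fy i]; first by rewrite !linear_sub0.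
by rewrite lf lg fx fy.
Qed.

End LinearClosure.

(** * Automation for linearity and for Sweedler sums *)

Ltac lin_leaf := solve [eauto 4 with lin nocore].

(* Under an anonymous binder a pattern variable such as [?g] only matches a   *)
(* subterm that does not mention the bound variable.                          *)
Ltac lin :=
  cbv beta;
  lazymatch goal with
  | |- forall _, _ => intro; lin
  | |- is_bilinear (_ _) => lin_leaf
  | |- is_bilinear _ => first [ solve [auto 2 with nocore] | split; intro; lin ]
  | |- GRing.linear_for _ (_ _) => lin_leaf
  | |- GRing.linear_for _ (fun x => x) => exact: linear_id_fun
  | |- GRing.linear_for _ (fun _ => 0) => exact: linear_zero
  | |- GRing.linear_for _ (fun x => _ + _) => refine (linear_add _ _); lin
  | |- GRing.linear_for _ (fun x => - _) => refine (linear_opp _); lin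
  | |- GRing.linear_for _ (fun x => @?c x *: _) =>
      lazymatch c with
      | (fun _ => ?c') => refine (linear_scale _ _); lin
      | _ => refine (linear_scalel _ _); lin
      end
  | |- GRing.linear_for _ (fun x => sweedler (@?t x) _) =>
      lazymatch t with
      | (fun _ => ?t') => refine (linear_sw_body _ _); lin
      | _ => refine (linear_sw_arg _ _); lin
      end
  | |- GRing.linear_for (@GRing.mul _) (fun x => ?g (@?u x)) =>
      refine (scalar_compose (g := g) (f := u) _ _); lin
  | |- GRing.linear_for _ (fun _ => ?g _) =>
      lazymatch goal with
      | |- _ (fun x => _ x) => lin_leaf
      | |- _ (fun x => _ (@?u x)) =>
          refine (linear_compose (g := g) (f := u) _ _); lin
      end
  | |- GRing.linear_for _ (fun _ => ?g _ ?w) =>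
      lazymatch goal with |- _ (fun x => _ (@?u x) _) =>
        refine (linear_bil1 (g := g) (f := u) w _ _); lin
      end
  | |- GRing.linear_for _ (fun _ => ?g _ ?w ?z) =>
      lazymatch goal with |- _ (fun x => _ (@?u x) _ _) =>
        refine (linear_tri1 (g := g) (f := u) w z _ _); lin
      end
  | |- _ => lin_leaf
  end.

Create HintDb lin.
#[global] Hint Resolve tpure_bilinear bilinear_linear : lin.

(** Flattens the left-hand side: a sum over a tensor that is itself a sum of pure tensors becomes a
    nested sum. The right-hand side is usually an existential variable that receives the result. *)
Ltac swn := cbv beta; lazymatch goal with
  | |- sweedler (sweedler _ _) _ = _ =>
      etransitivity; [refine (sw_sw _ _ _); lin | swn]
  | |- sweedler (tpure _ _) _ = _ =>
      etransitivity; [refine (sweedler_pure _ _ _); lin | swn]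
  | |- sweedler _ _ = _ => refine (eq_sw _ _); intros ? ?; swn
  | |- _ => try reflexivity
  end.

Lemma eq_replace T (x y l r : T) (G : Prop) :
  x = y -> x = l -> y = r -> (l = r -> G) -> G.
Proof. by move=> -> -> <-; apply. Qed.

(** Applies [f] to both sides of [E] and leaves the flattened equation as a premise of the goal. *)
Ltac sw_apply E f :=
  refine (eq_replace (congr1 f E) _ _ _); [swn | swn | ].

(** Moves the outermost sum inside the next [n] sums. *)
Ltac sink n :=
  lazymatch n with
  | 0%N => reflexivity
  | S ?n => etransitivity;
      [refine (exchange_sw _ _ _) | refine (eq_sw _ _); intros ? ?; sink n]
  end.

(** * The untwisted Hopf algebra *)

Section OperationsLinear.
Variables (k : fieldType) (H : homHopf k).

Lemma hopf_aut_linear : hom_hopf_algebra H -> linear (@aut k H).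
Proof. by case/hopf_object. Qed.

Lemma hopf_mul_bilinear : hom_hopf_algebra H -> is_bilinear (@hmul k H).
Proof. by move/hopf_algebra/hom_mul_bilinear. Qed.

Lemma hopf_comul_linear : hom_hopf_algebra H -> linear (@comul k H).
Proof. by move/hopf_coalgebra/hom_comul_linear. Qed.

Lemma hopf_counit_linear : hom_hopf_algebra H -> scalar (@counit k H).
Proof. by move/hopf_coalgebra/hom_counit_linear. Qed.

Lemma hyd_aut_linear (M : hyd H) : hyd_module M -> linear (@aut k M).
Proof. by case/hyd_object. Qed.

Lemma hyd_act_linear (M : hyd H) (h : H) : hyd_module M -> linear (@act k H M h).
Proof. by case/hyd_act_bilinear. Qed.

Lemma halg_mul_bilinear (A : hydAlg H) : hyd_algebra A -> is_bilinear (@amul k H A).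
Proof. by move/halg_algebra/hom_mul_bilinear. Qed.

End OperationsLinear.

#[global] Hint Resolve hopf_aut_linear hopf_mul_bilinear hopf_comul_linear
  hopf_counit_linear hopf_antipode_linear hyd_aut_linear hyd_act_linear
  hyd_act_bilinear hyd_coact_linear halg_module halg_mul_bilinear : lin.

Lemma involutive_iaut (k : fieldType) (X : homObj k) :
  involutive_object X -> @iaut k X = @aut k X.
Proof.
move=> invX; apply: funext => x.
apply: xget_unique => [|y <-]; first exact: invX.
by rewrite invX.
Qed.

Lemma iaut_eq (k : fieldType) (X : homObj k) (x y : X) :
  hom_object X -> aut y = x -> iaut x = y.
Proof.
move=> [_ /bij_inj inj] yx; apply: xget_unique => // z zx.
by apply: inj; rewrite yx.
Qed.

Section UntwistedHopf.
Variables (k : fieldType) (H : homHopf k).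
Hypotheses (hH : hom_hopf_algebra H) (H_inv : involutive_object H).
Local Notation α := (@aut k H).

(** The ordinary product whose twist by α is [hmul]: by multiplicativity of α, ab = α(a) * α(b) =
    α(a * b). *)
Definition star (a b : H) : H := α (hmul a b).
Definition cop (h : H) : tensor H H := comul (α h).

Lemma star_bilinear : is_bilinear star.
Proof. rewrite /star; lin. Qed.

Lemma cop_linear : linear cop.
Proof. rewrite /cop; lin. Qed.
Hint Resolve star_bilinear cop_linear : lin.

Let iautH := involutive_iaut H_inv.

Lemma aut_mul a b : α (hmul a b) = hmul (α a) (α b).
Proof. exact: hom_aut_mul (hopf_algebra hH) _ _. Qed.

Lemma hmul_star a b : hmul a b = star (α a) (α b).
Proof. by rewrite /star aut_mul !H_inv. Qed.

Lemma aut_star a b : α (star a b) = star (α a) (α b).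
Proof. by rewrite /star -aut_mul. Qed.

Lemma starA : associative star.
Proof.
move=> a b c; rewrite /star (aut_mul a) H_inv (aut_mul _ c) H_inv.
exact: hom_mulA (hopf_algebra hH) _ _ _.
Qed.

Lemma star1r a : star a hone = a.
Proof. by rewrite /star (hom_mul1r (hopf_algebra hH)) H_inv. Qed.

Section Functional.
Variable P : lmodType k.

(** Here and below the axioms are tested against an arbitrary multilinear [F]. They can then be used
    at any depth of a nested sum, without choosing a bracketing of iterated tensor products. *)
Lemma sw_comul_aut (F : H -> H -> P) h : is_bilinear F ->
  \sw_(a ⊗ b <- comul (α h)) F a b = \sw_(a ⊗ b <- comul h) F (α a) (α b).
Proof.
by move=> bF; sw_apply (hom_comul_aut (hopf_coalgebra hH) h)
  (fun t => sweedler t F).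
Qed.

Lemma sw_comul (F : H -> H -> P) h : is_bilinear F ->
  sweedler (comul h) F = \sw_(a ⊗ b <- cop h) F (α a) (α b).
Proof. by move=> bF; rewrite /cop -sw_comul_aut ?H_inv. Qed.

Lemma sw_cop_aut (F : H -> H -> P) h : is_bilinear F ->
  \sw_(a ⊗ b <- cop (α h)) F a b = \sw_(a ⊗ b <- cop h) F (α a) (α b).
Proof. exact: sw_comul_aut. Qed.

Lemma cop_coassoc (F : H -> H -> H -> P) h :
  (forall c, is_bilinear (fun a b => F a b c)) -> (forall a, is_bilinear (F a)) ->
  \sw_(a ⊗ p <- cop h) \sw_(b ⊗ c <- cop p) F a b c =
  \sw_(p ⊗ c <- cop h) \sw_(a ⊗ b <- cop p) F a b c.
Proof.
move=> bF1 bF2; have := hom_coassoc (hopf_coalgebra hH) (α h); rewrite iautH => E.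
sw_apply E
  (fun t => \sw_(a ⊗ u <- t) \sw_(b ⊗ c <- u) F (α a) (α b) (α c)) => {}E.
rewrite -/(cop h) in E.
etransitivity; [etransitivity; [|exact: E]|].
  apply: eq_sw => a b; rewrite H_inv sw_comul_aut //.
apply: eq_sw => a b; rewrite sw_comul_aut; last by lin.
by apply: eq_sw => c d; rewrite H_inv.
Qed.

Lemma cop_counitl (F : H -> P) h : linear F ->
  \sw_(a ⊗ b <- cop h) (counit a *: F b) = F h.
Proof.
move=> lF; have := hom_counitl (hopf_coalgebra hH) (α h).
rewrite iautH H_inv => E; rewrite -[in RHS]E.
rewrite linear_sweedler //; apply: eq_sw => a b.
by rewrite linearZ_fun.
Qed.

Lemma cop_counitr (F : H -> P) h : linear F ->
  \sw_(a ⊗ b <- cop h) (counit b *: F a) = F h.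
Proof.
move=> lF; have := hom_counitr (hopf_coalgebra hH) (α h).
rewrite iautH H_inv => E; rewrite -[in RHS]E.
rewrite linear_sweedler //; apply: eq_sw => a b.
by rewrite linearZ_fun.
Qed.

Lemma counit_aut h : counit (α h) = counit h.
Proof. exact: hom_counit_aut (hopf_coalgebra hH) h. Qed.

Lemma cop_antipodel (F : H -> P) h : linear F ->
  \sw_(a ⊗ b <- cop h) F (star (antipode a) b) = counit h *: F hone.
Proof.
move=> lF; have := hopf_antipodel hH (α h); rewrite counit_aut => E.
sw_apply E (fun x => F (α x)) => {}E.
rewrite -linearZ_fun // -(hom_aut_one (hopf_algebra hH)).
rewrite -(linearZ_fun _ _ (hopf_aut_linear hH)) -E.
by rewrite (linear_sweedler _ _ (hopf_aut_linear hH)) linear_sweedler.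
Qed.

Lemma cop_antipoder (F : H -> P) h : linear F ->
  \sw_(a ⊗ b <- cop h) F (star a (antipode b)) = counit h *: F hone.
Proof.
move=> lF; have := hopf_antipoder hH (α h); rewrite counit_aut => E.
sw_apply E (fun x => F (α x)) => {}E.
rewrite -linearZ_fun // -(hom_aut_one (hopf_algebra hH)).
rewrite -(linearZ_fun _ _ (hopf_aut_linear hH)) -E.
by rewrite (linear_sweedler _ _ (hopf_aut_linear hH)) linear_sweedler.
Qed.

Lemma cop_star (F : H -> H -> P) g h : is_bilinear F ->
  sweedler (cop (star g h)) F = \sw_(a ⊗ b <- cop g) \sw_(c ⊗ d <- cop h)
    F (star a c) (star b d).
Proof.
move=> bF; sw_apply (hopf_comul_mul hH g h) (fun t => sweedler t F) => E.
rewrite {1}/cop {1}/star H_inv {}E sw_comul; last by lin.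
apply: eq_sw => a b; rewrite sw_comul; last by lin.
by apply: eq_sw => c d; rewrite !hmul_star !H_inv.
Qed.

End Functional.
End UntwistedHopf.

#[local] Hint Resolve star_bilinear cop_linear : lin.

(** * Hom-Yetter-Drinfeld modules *)

Section HydFunctional.
Variables (k : fieldType) (H : homHopf k).
Hypotheses (hH : hom_hopf_algebra H) (H_inv : involutive_object H).
Local Notation α := (@aut k H).
Variable M : hyd H.
Hypotheses (hM : hyd_module M) (M_inv : involutive_object M).
Variable P : lmodType k.

Lemma sw_coact_aut (F : H -> M -> P) m : is_bilinear F ->
  sweedler (coact (aut m)) F = \sw_(a ⊗ m0 <- coact m) F (α a) (aut m0).
Proof. by move=> bF; sw_apply (hyd_coact_aut hM m) (fun t => sweedler t F). Qed.

Lemma sw_coactA (F : H -> H -> M -> P) m :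
  (forall c, is_bilinear (fun a b => F a b c)) -> (forall a, is_bilinear (F a)) ->
  \sw_(a ⊗ m0 <- coact m) \sw_(b ⊗ m00 <- coact m0) F a b m00 =
  \sw_(a ⊗ m0 <- coact m) \sw_(b ⊗ c <- cop a) F b (α c) (aut m0).
Proof.
move=> bF1 bF2; have := hyd_coactA hM m.
rewrite (involutive_iaut H_inv) (involutive_iaut M_inv) => E.
sw_apply E (fun t => \sw_(a ⊗ u <- t) \sw_(b ⊗ m0 <- u) F (α a) b m0) => {}E.
etransitivity; [etransitivity; [|symmetry; exact: E]|].
  by apply: eq_sw => a m0; rewrite H_inv.
apply: eq_sw => a m0; rewrite (sw_comul hH) //; last by lin.
by apply: eq_sw => b c; rewrite H_inv.
Qed.

Lemma sw_coact_counit (F : M -> P) m : linear F ->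
  \sw_(a ⊗ m0 <- coact m) (counit a *: F m0) = F (aut m).
Proof.
move=> lF; have := hyd_counit hM m; rewrite (involutive_iaut M_inv) => <-.
rewrite linear_sweedler //; apply: eq_sw => a m0.
by rewrite linearZ_fun.
Qed.

Lemma sw_coact_act (F : H -> M -> P) h m : is_bilinear F ->
  sweedler (coact (act h m)) F =
  \sw_(p ⊗ q <- cop h) \sw_(c ⊗ d <- cop p) \sw_(a ⊗ m0 <- coact m)
    F (star (star c (α a)) (antipode q)) (act (α d) m0).
Proof.
move=> bF; have := hyd_compat hM h m; rewrite (involutive_iaut H_inv) => E.
sw_apply E (fun t => sweedler t F) => {}E.
rewrite {}E (sw_comul hH) //; last by lin.
apply: eq_sw => p q; rewrite -/(cop p); apply: eq_sw => c d.
apply: eq_sw => a m0; rewrite (hmul_star hH) // -[X in star X]/(star _ _).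
by rewrite (hopf_antipode_aut hH) H_inv.
Qed.

(** In a tensor product [h] acts through α of the legs of [cop h]. Starting from α(h), the twists
    inside the formula collect into a single α on the [H]-leg. *)
Lemma sw_coact_act_aut (F : H -> M -> P) h m : is_bilinear F ->
  sweedler (coact (act (α h) m)) F =
  \sw_(p ⊗ q <- cop h) \sw_(c ⊗ d <- cop p) \sw_(a ⊗ m0 <- coact m)
    F (α (star (star c a) (antipode q))) (act d m0).
Proof.
move=> bF; rewrite sw_coact_act // (sw_cop_aut hH); last by lin.
apply: eq_sw => p q; rewrite (sw_cop_aut hH); last by lin.
apply: eq_sw => c d; apply: eq_sw => a m0; rewrite H_inv.
by rewrite (hopf_antipode_aut hH) -!(aut_star hH).
Qed.

End HydFunctional.

(** * Tensor products of Yetter-Drinfeld modules *)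

Section TensorModule.
Variables (k : fieldType) (H : homHopf k).
Hypotheses (hH : hom_hopf_algebra H) (H_inv : involutive_object H).
Local Notation α := (@aut k H).
Local Notation S := (@antipode k H).

(* The Yetter-Drinfeld condition on a tensor product: the inner factors       *)
(* [S p3] and [q1] cancel.                                                    *)
Lemma cop_conj (P : lmodType k) (F : H -> H -> H -> P) (x y h : H) :
  (forall c, is_bilinear (fun a b => F a b c)) -> (forall a, is_bilinear (F a)) ->
  \sw_(p ⊗ q <- cop h)
    \sw_(p' ⊗ p3 <- cop p) \sw_(p1 ⊗ p2 <- cop p')
    \sw_(q' ⊗ q3 <- cop q) \sw_(q1 ⊗ q2 <- cop q')
      F (star (star (star p1 x) (S p3)) (star (star q1 y) (S q3))) p2 q2 =
  \sw_(p ⊗ q <- cop h) \sw_(c ⊗ d <- cop p) \sw_(d1 ⊗ d2 <- cop d)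
    F (star (star c (star x y)) (S q)) d1 d2.
Proof.
move=> bF1 bF2.
etransitivity; [symmetry; refine (cop_coassoc hH H_inv (F := fun p' p3 q => 
    \sw_(p1 ⊗ p2 <- cop p')
    \sw_(q' ⊗ q3 <- cop q) \sw_(q1 ⊗ q2 <- cop q')
      F (star (star (star p1 x) (S p3)) (star (star q1 y) (S q3))) p2 q2) _ _ _); lin|].
transitivity (\sw_(p' ⊗ r <- cop h) \sw_(p1 ⊗ p2 <- cop p')
   \sw_(q2 ⊗ q3 <- cop r) F (star (star (star p1 x) y) (S q3)) p2 q2).
  apply: eq_sw => p' r; rewrite exchange_sw; apply: eq_sw => p1 p2.
  (* Splitting [q] from the left makes [p3] and [q1] neighbours. One more use of coassociativity
     makes them the two legs of a single element [t], where the antipode axiom applies. *)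
  transitivity (\sw_(p3 ⊗ q <- cop r) \sw_(q1 ⊗ s <- cop q) \sw_(q2 ⊗ q3 <- cop s)
      F (star (star (star p1 x) (S p3)) (star (star q1 y) (S q3))) p2 q2).
    apply: eq_sw => p3 q; symmetry.
    refine (cop_coassoc hH H_inv (F := fun q1 q2 q3 =>
      F (star (star (star p1 x) (S p3)) (star (star q1 y) (S q3))) p2 q2) _ _ _); lin.
  etransitivity; [refine (cop_coassoc hH H_inv (F := fun p3 q1 s =>
    \sw_(q2 ⊗ q3 <- cop s)
      F (star (star (star p1 x) (S p3)) (star (star q1 y) (S q3))) p2 q2) _ _ _); lin|].
  etransitivity; last first.
    refine (cop_counitl hH H_inv (F := fun r => \sw_(q2 ⊗ q3 <- cop r)
      F (star (star (star p1 x) y) (S q3)) p2 q2) _ _); lin.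
  apply: eq_sw => t s; rewrite exchange_sw scale_sw; apply: eq_sw => q2 q3.
  transitivity (\sw_(a ⊗ b <- cop t)
      F (star (star (star p1 x) (star (S a) b)) (star y (S q3))) p2 q2).
    by apply: eq_sw => a b; rewrite !(starA hH H_inv).
  etransitivity; [refine (cop_antipodel hH (F := fun z =>
    F (star (star (star p1 x) z) (star y (S q3))) p2 q2) _ _); lin |].
  by cbv beta; rewrite (star1r hH H_inv) !(starA hH H_inv).
etransitivity; last first.
  apply: eq_sw => p q; symmetry.
  refine (cop_coassoc hH H_inv (F := fun c d1 d2 =>
     F (star (star c (star x y)) (S q)) d1 d2) _ _ _); lin.
transitivity (\sw_(p' ⊗ r <- cop h) \sw_(q2 ⊗ q3 <- cop r)
   \sw_(p1 ⊗ p2 <- cop p') F (star (star (star p1 x) y) (S q3)) p2 q2).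
  by apply: eq_sw => p' r; rewrite exchange_sw.
etransitivity; [refine (cop_coassoc hH H_inv (F := fun p' q2 q3 =>
   \sw_(p1 ⊗ p2 <- cop p') F (star (star (star p1 x) y) (S q3)) p2 q2) _ _ _); lin|].
apply: eq_sw => p q; apply: eq_sw => p' q2; apply: eq_sw => p1 p2.
by rewrite !(starA hH H_inv).
Qed.

Variables M N : hyd H.
Hypotheses (hM : hyd_module M) (hN : hyd_module N).
Hypotheses (M_inv : involutive_object M) (N_inv : involutive_object N).
Local Notation MN := (hyd_tensor M N).

Lemma tensor_aut_linear : linear (@aut k MN).
Proof. rewrite /=; lin. Qed.

Lemma tensor_act_bilinear : is_bilinear (@act k H MN).
Proof. rewrite /=; lin. Qed.

Lemma tensor_coact_linear : linear (@coact k H MN).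
Proof. rewrite /=; lin. Qed.
Hint Resolve tensor_aut_linear tensor_act_bilinear tensor_coact_linear : lin.

Lemma tensor_aut_pure (m : M) (n : N) : @aut k MN (m ⊗ n) = aut m ⊗ aut n.
Proof. rewrite /= sweedler_pure //; lin. Qed.

Lemma tensor_act_pure h (m : M) (n : N) : @act k H MN h (m ⊗ n) =
  \sw_(p ⊗ q <- cop h) (act (α p) m ⊗ act (α q) n).
Proof.
rewrite /= (sw_comul hH) //; last by lin.
by apply: eq_sw => a b; rewrite sweedler_pure //; lin.
Qed.

Lemma tensor_coact_pure (m : M) (n : N) : @coact k H MN (m ⊗ n) =
  \sw_(a ⊗ m0 <- coact m) \sw_(b ⊗ n0 <- coact n) (hmul a b ⊗ (m0 ⊗ n0)).
Proof. rewrite /= sweedler_pure //; lin. Qed.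

Lemma tensor_involutive : involutive_object MN.
Proof.
apply: eq_tensor_linear; [lin | lin | move=> m n].
by rewrite !tensor_aut_pure M_inv N_inv.
Qed.

Lemma tensor_compat h (t : MN) : coact (act h t) =
  \sw_(h1 ⊗ h2 <- comul h) \sw_(h11 ⊗ h12 <- comul h1) \sw_(a ⊗ t0 <- coact t)
    (hmul (hmul h11 (iaut a)) (antipode h2) ⊗ (act (aut h12) t0 : MN)).
Proof.
rewrite (involutive_iaut H_inv); move: t.
apply: eq_tensor_linear; [lin | lin | move=> m n].
(* Both coactions are moved outermost: for fixed legs of [m] and [n], what is left is the identity
   [cop_conj] in [H]. *)
transitivity (\sw_(a ⊗ m0 <- coact m) \sw_(b ⊗ n0 <- coact n)
  \sw_(p ⊗ q <- cop h)
    \sw_(p' ⊗ p3 <- cop p) \sw_(p1 ⊗ p2 <- cop p')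
    \sw_(q' ⊗ q3 <- cop q) \sw_(q1 ⊗ q2 <- cop q')
      (star (star (star p1 a) (S p3)) (star (star q1 b) (S q3)) ⊗
         (act p2 m0 ⊗ act q2 n0))).
  symmetry; etransitivity.
    by refine (eq_sw _ _) => a m0; sink 5%N.
  etransitivity; first sink 3%N.
  rewrite tensor_act_pure (linear_sweedler _ _ tensor_coact_linear).
  apply: eq_sw => p q; rewrite tensor_coact_pure.
  rewrite (sw_coact_act_aut hH H_inv hM); last by lin.
  apply: eq_sw => p' p3; apply: eq_sw => p1 p2; apply: eq_sw => a m0.
  rewrite (sw_coact_act_aut hH H_inv hN); last by lin.
  apply: eq_sw => q' q3; apply: eq_sw => q1 q2; apply: eq_sw => b n0.
  by rewrite (hmul_star hH) // !H_inv.
transitivity (\sw_(a ⊗ m0 <- coact m) \sw_(b ⊗ n0 <- coact n)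
  \sw_(p ⊗ q <- cop h) \sw_(c ⊗ d <- cop p) \sw_(d1 ⊗ d2 <- cop d)
    (star (star c (star a b)) (S q) ⊗ (act d1 m0 ⊗ act d2 n0))).
  apply: eq_sw => a m0; apply: eq_sw => b n0.
  refine (cop_conj (F := fun u v w => u ⊗ (act v m0 ⊗ act w n0)) _ _ _ _ _); lin.
etransitivity.
  by refine (eq_sw _ _) => a m0; sink 2%N.
etransitivity; first sink 2%N.
rewrite [RHS](sw_comul hH) //; last by lin.
apply: eq_sw => p q; rewrite -/(cop p); apply: eq_sw => c d.
rewrite tensor_coact_pure; symmetry; swn.
rewrite tensor_act_pure (sw_cop_aut hH) //; last by lin.
rewrite (linear_sweedler _ _ ((tpure_bilinear _ _).2 _)).
apply: eq_sw => d1 d2; rewrite !H_inv; congr (_ ⊗ _).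
by rewrite (hopf_antipode_aut hH) (hmul_star hH) // H_inv.
Qed.

Lemma tensor_coactA (t : MN) :
  \sw_(a ⊗ m0 <- coact t) \sw_(a1 ⊗ a2 <- comul a)
      (a1 ⊗ (a2 ⊗ iaut m0)) =
  \sw_(a ⊗ m0 <- coact t) (iaut a ⊗ coact m0).
Proof.
rewrite (involutive_iaut H_inv) (involutive_iaut tensor_involutive).
move: t; apply: eq_tensor_linear; [lin | lin | move=> m n].
rewrite tensor_coact_pure; etransitivity; [swn | symmetry; etransitivity; [swn | ]].
(* The common form of both sides: coassociativity of the coaction is applied to [m] and to [n]
   separately, one nested in the other. *)
transitivity (\sw_(a ⊗ b <- coact m) \sw_(c ⊗ d <- cop a)
  \sw_(a' ⊗ b' <- coact n) \sw_(c' ⊗ d' <- cop a')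
    (hmul (α c) (α c') ⊗ (hmul (α d) (α d') ⊗ (aut b ⊗ aut b')))).
  transitivity (\sw_(a ⊗ b <- coact m) \sw_(c ⊗ b0 <- coact b)
    \sw_(a' ⊗ b' <- coact n) \sw_(c' ⊗ b0' <- coact b')
      (hmul (α a) (α a') ⊗ (hmul c c' ⊗ (b0 ⊗ b0')))).
    apply: eq_sw => a b; rewrite exchange_sw; apply: eq_sw => a' b'.
    rewrite tensor_coact_pure (linear_sweedler _ _ ((tpure_bilinear _ _).2 _)).
    apply: eq_sw => c b0; rewrite (linear_sweedler _ _ ((tpure_bilinear _ _).2 _)).
    by apply: eq_sw => c' b0'; rewrite (aut_mul hH).
  etransitivity.
    refine (sw_coactA hH H_inv hM M_inv (F := fun a c b0 =>
      \sw_(a' ⊗ b' <- coact n) \sw_(c' ⊗ b0' <- coact b')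
      (hmul (α a) (α a') ⊗ (hmul c c' ⊗ (b0 ⊗ b0')))) _ _ _); lin.
  apply: eq_sw => a b; apply: eq_sw => c d.
  refine (sw_coactA hH H_inv hN N_inv (F := fun a' c' b0' =>
      (hmul (α c) (α a') ⊗ (hmul (α d) c' ⊗ (aut b ⊗ b0')))) _ _ _); lin.
apply: eq_sw => a b; rewrite exchange_sw; apply: eq_sw => a' b'.
rewrite (hopf_comul_mul hH) tensor_aut_pure; symmetry; etransitivity; first swn.
rewrite (sw_comul hH) //; last by lin.
apply: eq_sw => c d; rewrite (sw_comul hH) //; lin.
Qed.

Lemma tensor_module : hyd_module MN.
Proof.
split; try solve [lin].
- by split; [lin | exact: inv_bij tensor_involutive].
- move=> h g; apply: eq_tensor_linear; [lin | lin | move=> m n].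
  rewrite tensor_aut_pure !tensor_act_pure.
  rewrite (linear_sweedler _ _ (tensor_act_bilinear.2 _)).
  rewrite [hmul h g](hmul_star hH) // (cop_star hH) //; last by lin.
  rewrite (sw_cop_aut hH); last by lin.
  rewrite [RHS]exchange_sw (sw_cop_aut hH); last by lin.
  apply: eq_sw => c d; rewrite tensor_act_pure (sw_cop_aut hH); last by lin.
  apply: eq_sw => p q; rewrite !(hyd_actA hM) !(hyd_actA hN).
  by rewrite -!(hmul_star hH) // -!(aut_mul hH).
- apply: eq_tensor_linear; [lin | lin | move=> m n].
  rewrite tensor_aut_pure /= (hopf_comul_one hH); swn.
  by rewrite (hyd_act1 hM) (hyd_act1 hN).
- move=> h; apply: eq_tensor_linear; [lin | lin | move=> m n].
  rewrite tensor_aut_pure !tensor_act_pure (sw_cop_aut hH); last by lin.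
  rewrite (linear_sweedler _ _ tensor_aut_linear); apply: eq_sw => p q.
  by rewrite tensor_aut_pure (hyd_aut_act hM) (hyd_aut_act hN).
- exact: tensor_coactA.
- apply: eq_tensor_linear; [lin | lin | move=> m n].
  rewrite tensor_aut_pure !tensor_coact_pure; symmetry; etransitivity; first swn.
  symmetry; rewrite (sw_coact_aut hM); last by lin.
  apply: eq_sw => a m0; rewrite (sw_coact_aut hN); last by lin.
  by apply: eq_sw => b n0; rewrite tensor_aut_pure (aut_mul hH).
- rewrite (involutive_iaut tensor_involutive).
  apply: eq_tensor_linear; [lin | lin | move=> m n].
  rewrite tensor_aut_pure !tensor_coact_pure; etransitivity; first swn.
  rewrite -(sw_coact_counit hM M_inv (F := fun m => m ⊗ aut n)); last by lin.
  apply: eq_sw => a m0.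
  rewrite -(sw_coact_counit hN N_inv (F := fun n => m0 ⊗ n)); last by lin.
  rewrite scale_sw; apply: eq_sw => b n0.
  by rewrite (hopf_counit_mul hH) scalerA.
- exact: tensor_compat.
Qed.
End TensorModule.

(** * The unit object *)

Section UnitModule.
Variables (k : fieldType) (H : homHopf k).
Hypotheses (hH : hom_hopf_algebra H) (H_inv : involutive_object H).
Local Notation α := (@aut k H).

Lemma sw_unit_coact (P : lmodType k) (F : H -> k^o -> P) (c : hyd_unit H) :
  is_bilinear F -> sweedler (coact c) F = F hone c.
Proof.
move=> bF; rewrite /= (linearZ_fun _ _ (sweedler_linear bF)) sweedler_pure //.
by rewrite -(linearZ_fun _ _ (bF.2 _)) /GRing.scale /= mulr1.
Qed.

Lemma unit_coactE (c : hyd_unit H) : coact c = hone ⊗ (c : k^o).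
Proof. by rewrite -[LHS]sweedler_id sw_unit_coact //; apply: tpure_bilinear. Qed.

Lemma unit_act_bilinear : is_bilinear (@act k H (hyd_unit H)).
Proof.
rewrite /=; lin.
Qed.
Hint Resolve unit_act_bilinear : lin.

Lemma unit_involutive : involutive_object (hyd_unit H).
Proof. by []. Qed.

Lemma unit_module : hyd_module (hyd_unit H).
Proof.
have one1 := hom_aut_one (hopf_algebra hH).
have lid : linear (@aut k (hyd_unit H)) by [].
have i1 : @iaut k (hyd_unit H) = id.
  exact: (involutive_iaut (X := hyd_unit H) unit_involutive).
split; try solve [lin].
- by split; [|exists id].
- by rewrite /=; lin.
- move=> h g m /=; rewrite (counit_aut hH) (hopf_counit_mul hH).
  by rewrite scalerA.
- by move=> m /=; rewrite (hopf_counit_one hH) scale1r.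
- by move=> h m /=; rewrite (counit_aut hH).
- move=> m; rewrite i1 (involutive_iaut H_inv).
  rewrite !sw_unit_coact; [|rewrite /=; lin..].
  by rewrite (hopf_comul_one hH) sweedler_pure ?unit_coactE ?one1 //; lin.
- by move=> m; rewrite sw_unit_coact; [rewrite unit_coactE one1|rewrite /=; lin].
- move=> m; rewrite sw_unit_coact; last lin.
  by rewrite (hopf_counit_one hH) i1 scale1r.
move=> h m; rewrite unit_coactE (involutive_iaut H_inv).
rewrite (sw_comul hH H_inv); last by rewrite /=; lin.
(* The trivial action applies the counit to the leg of [h] that acts, so the condition reduces to
   the antipode axiom h1 S(h2) = ε(h) 1. *)
transitivity (\sw_(p ⊗ q <- cop h) ((star p (antipode q) : H) ⊗ (m : k^o))).
  rewrite (cop_antipoder hH (F := fun x => x ⊗ (m : k^o))); last by lin.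
  by rewrite -(linearZ_fun _ _ ((tpure_bilinear _ _).2 _)).
apply: eq_sw => p q; rewrite -/(cop p).
rewrite -(cop_counitr hH H_inv
  (F := fun p => star p (antipode q) ⊗ (m : k^o))); last by lin.
apply: eq_sw => c d; rewrite sw_unit_coact; last by lin.
rewrite /= (linearZ_fun _ _ ((tpure_bilinear _ _).2 _)) (counit_aut hH).
rewrite one1 (hom_mul1r (hopf_algebra hH)) (hmul_star hH) // H_inv.
by rewrite hopf_antipode_aut // H_inv.
Qed.

End UnitModule.

(** * Direct sums *)

Section DirectSumMaps.
Variables (k : fieldType) (V : nat -> lmodType k).

Lemma dinjE i (x : V i) j : dinj V i x j = dfwith (fun j => 0 : V j) x j.
Proof. by []. Qed.

Lemma dinj_linear i : linear (dinj V i).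
Proof.
move=> c x y; apply/dsumP => j.
change (dfwith (fun j => 0 : V j) (c *: x + y) j =
  c *: dfwith (fun j => 0 : V j) x j + dfwith (fun j => 0 : V j) y j).
by case: (eqVneq i j) => [<-|ij]; rewrite ?dfwith_in ?dfwith_out // scaler0 addr0.
Qed.

Section Lift.
Variables (P : lmodType k) (f : forall i, V i -> P).
Hypothesis lf : forall i, linear (@f i).

(** The automorphism, action and coaction of [talg_hyd] have this form, and the product of
    [tensor_alg] is an instance of [dlift2], up to conversion; the lemmas on lifts thus apply to
    them directly. *)
Definition dlift (x : dsum V) : P := \sum_(i \in [set: nat]) f (x i).

Lemma dlift_ord (x : dsum V) n : (forall i, (n <= i)%N -> x i = 0) ->
  dlift x = \sum_(i < n) f (x i).
Proof.
move=> xn; rewrite -(big_mkord predT (fun i => f (x i))) /dlift.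
rewrite (fsbigE (index_iota 0 n)) ?iota_uniq // => [|i _].
  by apply: eq_bigl => i; rewrite in_setT.
by rewrite mem_index_iota /= -leqNgt => /xn ->; apply: linear_sub0.
Qed.

Lemma dlift_linear : linear dlift.
Proof.
move=> c x y; have [[m xm] [n yn]] := (dsum_finite x, dsum_finite y).
pose N := maxn m n.
have xN i : (N <= i)%N -> x i = 0 by rewrite geq_max => /andP[/xm].
have yN i : (N <= i)%N -> y i = 0 by rewrite geq_max => /andP[_ /yn].
have xyN i : (N <= i)%N -> (c *: x + y) i = 0.
  by move=> Ni; rewrite -[LHS]/(c *: x i + y i) xN // yN // scaler0 addr0.
rewrite (dlift_ord xN) (dlift_ord yN) (dlift_ord xyN) scaler_sumr -big_split /=.
by apply: eq_bigr => i _; rewrite -lf.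
Qed.

Lemma dlift_inj i (x : V i) : dlift (dinj V i x) = f x.
Proof.
rewrite (@dlift_ord _ i.+1) => [|j ij]; last first.
  by rewrite dinjE dfwith_out // neq_ltn ij.
rewrite big_ord_recr big1 => [|j _].
  by rewrite [LHS]add0r dinjE dfwith_in.
by rewrite dinjE dfwith_out ?linear_sub0 //= neq_ltn ltn_ord orbT.
Qed.

End Lift.

Lemma dlift_fun_linear (U P : lmodType k) (f : U -> forall j, V j -> P) (t : dsum V) :
  (forall u j, linear (f u j)) -> (forall j y, linear (fun u => f u j y)) ->
  linear (fun u => dlift (f u) t).
Proof.
move=> lf1 lf2 c u v; have [n tn] := dsum_finite t.
rewrite !(dlift_ord _ tn) // scaler_sumr -big_split /=.
by apply: eq_bigr => j _; rewrite lf2.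
Qed.

Lemma dsum_sum (x : dsum V) n : (forall i, (n <= i)%N -> x i = 0) ->
  x = \sum_(i < n) dinj V i (x i).
Proof.
move=> xn; apply/dsumP => j; have lev : linear (fun y : dsum V => y j) by [].
rewrite (linear_sum_fun _ _ _ lev).
case: (ltnP j n) => [jn|nj].
  rewrite (bigD1 (Ordinal jn)) //= dfwith_in big1 ?addr0 // => i ij.
  by rewrite dfwith_out //.
rewrite xn // big1 // => i _; rewrite dinjE dfwith_out // neq_ltn.
by rewrite (leq_trans (ltn_ord i) nj).
Qed.

Lemma dsum_ind_inj (Q : set (dsum V)) : subspace Q ->
  (forall i x, Q (dinj V i x)) -> forall x, Q x.
Proof.
move=> [Q0 QD] Qi x; have [n xn] := dsum_finite x; rewrite (dsum_sum xn).
apply: (big_ind Q) => // u v Qu Qv.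
by rewrite -[u]scale1r; apply: QD.
Qed.

Lemma eq_dsum_linear (P : lmodType k) (f g : dsum V -> P) :
  linear f -> linear g -> (forall i x, f (dinj V i x) = g (dinj V i x)) -> f =1 g.
Proof.
move=> lf lg fg; apply: dsum_ind_inj => //; split=> [|c x y /= fx fy].
  by rewrite /= !linear_sub0.
by rewrite lf lg fx fy.
Qed.

End DirectSumMaps.

Section BilinearLift.
Variables (k : fieldType) (V W : nat -> lmodType k) (P : lmodType k).

Variable f : forall i j, V i -> W j -> P.
Hypothesis bf : forall i j, is_bilinear (@f i j).

Definition dlift2 (s : dsum V) (t : dsum W) : P :=
  dlift (fun i x => dlift (fun j y => f x y) t) s.

Lemma dlift2_bilinear : is_bilinear dlift2.
Proof.
split=> [t | s].
  apply: dlift_linear => i; apply: dlift_fun_linear => [u j | j y].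
    exact: (bf i j).2.
  exact: (bf i j).1.
rewrite /dlift2; apply: (dlift_fun_linear (U := dsum W)
  (f := fun t i x => dlift (fun j y => f x y) t)) => [t i | i x].
  apply: dlift_fun_linear => [u j | j y]; first exact: (bf i j).2.
  exact: (bf i j).1.
by apply: dlift_linear => j; apply: (bf i j).2.
Qed.

Lemma dlift2_inj i j (x : V i) (y : W j) :
  dlift2 (dinj V i x) (dinj W j y) = f x y.
Proof.
rewrite /dlift2 dlift_inj => [|i'].
  by rewrite dlift_inj // => j'; apply: (bf i j').2.
apply: dlift_fun_linear => [u j' | j' y']; first exact: (bf i' j').2.
exact: (bf i' j').1.
Qed.

End BilinearLift.

(** * The tensor algebra *)

Section TensorAlgebraModule.
Variables (k : fieldType) (H : homHopf k).
Hypotheses (hH : hom_hopf_algebra H) (H_inv : involutive_object H).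
Local Notation α := (@aut k H).
Variable M : hyd H.
Hypotheses (hM : hyd_module M) (M_inv : involutive_object M).
Local Notation T := (talg_hyd M).

(** The two claims go together: [tensor_module] needs both factors to be involutive. *)
Lemma tpow_module_involutive i : hyd_module (tpow M i) /\ involutive_object (tpow M i).
Proof.
elim: i => [|[|i] [mi ii]]; first by split; [exact: unit_module|].
  by [].
by split; [exact: tensor_module | exact: tensor_involutive].
Qed.

Lemma tpow_module i : hyd_module (tpow M i).
Proof. exact: (tpow_module_involutive i).1. Qed.

Lemma tpow_involutive i : involutive_object (tpow M i).
Proof. exact: (tpow_module_involutive i).2. Qed.

Lemma tinj_linear i : linear (@tinj k H M i : tpow M i -> T).
Proof. exact: dinj_linear. Qed.
Hint Resolve tpow_module tinj_linear : lin.

Lemma eq_talg_linear (P : lmodType k) (f g : T -> P) :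
  linear f -> linear g -> (forall i (x : tpow M i), f (tinj x) = g (tinj x)) -> f =1 g.
Proof. exact: eq_dsum_linear. Qed.

Lemma talg_aut_linear : linear (@aut k T).
Proof.
apply: (dlift_linear (V := fun i => tpow M i) (P := T)
  (f := fun i x => tinj (aut x))) => i; lin.
Qed.

Lemma talg_autE i (x : tpow M i) : @aut k T (tinj x) = tinj (aut x).
Proof.
apply: (dlift_inj (V := fun i => tpow M i) (P := T)
  (f := fun i x => tinj (aut x))) => {x}i; lin.
Qed.

Lemma talg_actE h i (x : tpow M i) : @act k H T h (tinj x) = tinj (act h x).
Proof.
apply: (dlift_inj (V := fun i => tpow M i) (P := T)
  (f := fun i x => tinj (act h x))) => {x}i; lin.
Qed.

Lemma talg_act_linear h : linear (@act k H T h).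
Proof.
apply: (dlift_linear (V := fun i => tpow M i) (P := T)
  (f := fun i x => tinj (act h x))) => i; lin.
Qed.
Hint Resolve talg_aut_linear talg_act_linear : lin.

Lemma talg_act_bilinear : is_bilinear (@act k H T).
Proof.
split=> [t c g h|h]; last lin.
move: t.
apply: eq_talg_linear; [lin|lin|move=> i x].
rewrite !talg_actE ((hyd_act_bilinear (tpow_module i)).1 x).
exact: tinj_linear.
Qed.

Lemma talg_coact_linear : linear (@coact k H T).
Proof.
apply: (dlift_linear (V := fun i => tpow M i) (P := tensor H T)
  (f := fun i x => \sw_(a ⊗ y <- coact x) (a ⊗ (tinj y : T)))) => i; lin.
Qed.
Hint Resolve talg_act_bilinear talg_coact_linear : lin.

Lemma talg_coactE i (x : tpow M i) :
  @coact k H T (tinj x) = \sw_(a ⊗ y <- coact x) (a ⊗ (tinj y : T)).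
Proof.
apply: (dlift_inj (V := fun i => tpow M i) (P := tensor H T)
  (f := fun i x => \sw_(a ⊗ y <- coact x) (a ⊗ (tinj y : T)))) => {x}i; lin.
Qed.

Lemma talg_involutive : involutive_object T.
Proof.
apply: eq_talg_linear; [lin|lin|move=> i x].
by rewrite !talg_autE tpow_involutive.
Qed.

Lemma sw_talg_coact (P : lmodType k) (F : H -> T -> P) i (x : tpow M i) :
  is_bilinear F ->
  sweedler (@coact k H T (tinj x)) F = \sw_(a ⊗ y <- coact x) F a (tinj y).
Proof. by move=> bF; rewrite talg_coactE; swn. Qed.

Lemma talg_module : hyd_module T.
Proof.
split; try solve [lin].
- by split; [lin | exact: inv_bij talg_involutive].
- move=> h g; apply: eq_talg_linear; [lin|lin|move=> i x].
  by rewrite talg_autE !talg_actE (hyd_actA (tpow_module i)).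
- apply: eq_talg_linear; [lin|lin|move=> i x].
  by rewrite talg_autE !talg_actE (hyd_act1 (tpow_module i)).
- move=> h; apply: eq_talg_linear; [lin|lin|move=> i x].
  by rewrite !(talg_autE, talg_actE) (hyd_aut_act (tpow_module i)).
- rewrite (involutive_iaut H_inv) (involutive_iaut talg_involutive).
  apply: eq_talg_linear; [lin|lin|move=> i x].
  rewrite !sw_talg_coact; [|lin..].
  have := hyd_coactA (tpow_module i) x.
  rewrite (involutive_iaut H_inv) (involutive_iaut (@tpow_involutive i)) => E.
  sw_apply E (fun t : tensor H (tensor H (tpow M i)) =>
    \sw_(a ⊗ u <- t) \sw_(b ⊗ y <- u)
    (a ⊗ (b ⊗ (@tinj k H M i y : T)))) => {}E.
  etransitivity; [etransitivity; last exact: E |].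
    by apply: eq_sw => a y; apply: eq_sw => b c; rewrite talg_autE.
  apply: eq_sw => a y; rewrite talg_coactE.
  by rewrite (linear_sweedler _ _ ((tpure_bilinear _ _).2 _)).
- apply: eq_talg_linear; [lin|lin|move=> i x].
  rewrite talg_autE sw_talg_coact; last lin.
  rewrite talg_coactE (sw_coact_aut (tpow_module i)); last lin.
  by apply: eq_sw => a y; rewrite talg_autE.
- rewrite (involutive_iaut talg_involutive).
  apply: eq_talg_linear; [lin|lin|move=> i x].
  rewrite talg_autE sw_talg_coact; last lin.
  by rewrite (sw_coact_counit (tpow_module i) (@tpow_involutive i)
    (F := @tinj k H M i : _ -> T)); last lin.
- move=> h; rewrite (involutive_iaut H_inv).
  apply: eq_talg_linear; [lin|lin|move=> i x].
  rewrite talg_actE talg_coactE.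
  have := hyd_compat (tpow_module i) h x.
  rewrite (involutive_iaut H_inv) => E.
  sw_apply E (fun t : tensor H (tpow M i) =>
    \sw_(a ⊗ y <- t) (a ⊗ (@tinj k H M i y : T))) => {}E.
  rewrite E; apply: eq_sw => p q; apply: eq_sw => c d.
  rewrite sw_talg_coact; last lin.
  by apply: eq_sw => a y; rewrite talg_actE.
Qed.

End TensorAlgebraModule.

#[local] Hint Resolve star_bilinear cop_linear tpow_module tinj_linear : lin.
#[local] Hint Resolve talg_aut_linear talg_act_linear : lin.
#[local] Hint Resolve talg_act_bilinear talg_coact_linear talg_module : lin.

Lemma iter_linear (k : fieldType) (V : lmodType k) n (f : V -> V) :
  linear f -> linear (iter n f).
Proof. by move=> lf; elim: n => [|n IH] // c x y; rewrite /= IH lf. Qed.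
#[local] Hint Resolve iter_linear : lin.

#[local] Arguments aut : simpl never.
#[local] Arguments act : simpl never.
#[local] Arguments coact : simpl never.
#[local] Arguments amul : simpl never.
#[local] Arguments aone : simpl never.

(** * The product of the tensor algebra *)

Section TensorAlgebraMul.
Variables (k : fieldType) (H : homHopf k).
Hypotheses (hH : hom_hopf_algebra H) (H_inv : involutive_object H).
Local Notation α := (@aut k H).
Variable M : hyd H.
Hypotheses (hM : hyd_module M) (M_inv : involutive_object M).
Local Notation T := (talg_hyd M).
Local Notation A := (tensor_alg M).
Local Notation β := (@aut k T).
Local Notation ι := (@tinj k H M 1 : M -> A).

Let autE := talg_autE hH H_inv hM M_inv.
Let actE := talg_actE hH H_inv hM M_inv.
Let coactE := talg_coactE hH H_inv hM M_inv.
Let modE i := tpow_module hH H_inv hM M_inv i.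
Let T_inv := talg_involutive hH H_inv hM M_inv.

Lemma tensor_alg_module : hyd_module A.
Proof. exact: talg_module. Qed.
Hint Resolve tensor_alg_module : lin.

Lemma tinj1_linear : linear (@tinj k H M 1 : M -> A).
Proof. exact: (@tinj_linear k H M 1). Qed.
Hint Resolve tinj1_linear : lin.

Lemma tcat_bilinear i j : is_bilinear (@tcat k H M i j).
Proof.
elim: j => [|j IH] /=; first exact: tpure_bilinear.
split=> [y|x].
  apply: (linear_sw_body (V := tpow M j.+1) (W := M)) => y' m.
  apply: (linear_bil1 (g := @tpure k (tpow M (j + i).+2) M) (f := fun x => tcat x y')).
    exact: tpure_bilinear.
  exact: IH.1.
apply: (sweedler_linear (V := tpow M j.+1) (W := M)).
split=> [m|y'].
  apply: (linear_bil1 (g := @tpure k (tpow M (j + i).+2) M) (f := fun y' => tcat x y')).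
    exact: tpure_bilinear.
  exact: IH.2.
exact: (tpure_bilinear _ _).2.
Qed.

Lemma aut_tail_linear j : linear (@aut_tail k H M j).
Proof.
elim: j => [|j IH] //=.
apply: (sweedler_linear (V := tpow M j.+1) (W := M)); lin.
Qed.

Lemma tmul_hom_bilinear i j : is_bilinear (@tmul_hom k H M i j : _ -> _ -> T).
Proof.
have tl n : linear (@tinj k H M n : _ -> T) by exact: tinj_linear.
have al n : linear (@aut k (tpow M n)) by lin.
case: i => [|i].
  split=> [y|c] /=; apply: (linear_compose (tl _)).
    by apply: (linear_scalel (V := k^o)).
  exact: linear_scale.
case: j => [|j] /=.
  split=> [c|x]; apply: (linear_compose (tl _)).
    by apply: linear_scale; exact: (al i.+1).
  by apply: (linear_scalel (V := k^o)).
split=> [y|x]; apply: (linear_compose (tl _)).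
  exact: (linear_bil1 _ (tcat_bilinear i j) (iter_linear j (al i.+1))).
exact: (linear_bil2 _ (tcat_bilinear i j) (@aut_tail_linear j)).
Qed.

Lemma talg_mul_bilinear : is_bilinear (@amul k H A).
Proof. exact: (dlift2_bilinear (P := T) tmul_hom_bilinear). Qed.

Lemma talg_mulE i j (x : tpow M i) (y : tpow M j) :
  @amul k H A (tinj x) (tinj y) = tmul_hom x y.
Proof. exact: (dlift2_inj (P := T) tmul_hom_bilinear). Qed.
Hint Resolve talg_mul_bilinear : lin.

Lemma talg_mul1l (t : A) : amul aone t = aut t.
Proof.
move: t; apply: (@eq_talg_linear k H M T); [lin|lin|move=> i x].
rewrite autE; transitivity (@tmul_hom k H M 0 i (1 : k) x).
  exact: (@talg_mulE 0 i (1 : k) x).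
by rewrite /= scale1r.
Qed.

Lemma talg_mul1r (t : A) : amul t aone = aut t.
Proof.
move: t; apply: (@eq_talg_linear k H M T); [lin|lin|move=> i x].
rewrite autE; transitivity (@tmul_hom k H M i 0 x (1 : k)).
  exact: (@talg_mulE i 0 x (1 : k)).
case: i x => [c|i x] /=; last by rewrite scale1r.
by rewrite /GRing.scale /= mulr1.
Qed.

Lemma tinj_tensor i (x : tpow M i.+1) (m : M) :
  tinj (x ⊗ m : tpow M i.+2) = amul (tinj x : A) (ι m).
Proof. by rewrite talg_mulE. Qed.

(** The induction principle behind all the identities in T(M): [tinj_tensor] turns the last tensor
    factor into a right multiplication. *)
Lemma talg_ind (Q : set A) : subspace Q -> Q aone ->
  (forall t m, Q t -> Q (amul t (ι m))) -> forall t, Q t.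
Proof.
move=> sQ Q1 QM; apply: dsum_ind_inj => // i x; change (Q (tinj x)).
have QZ c t : Q t -> Q (c *: t).
  by move=> Qt; rewrite -[X in Q X]addr0; apply: sQ.2 => //; case: sQ.
elim: i x => [c|[_ m|i IH x]].
- have -> : tinj c = c *: (aone : A); last exact: QZ.
  rewrite -(linearZ_fun _ _ (@tinj_linear k H M 0)); congr tinj.
  by rewrite /GRing.scale /= mulr1.
(* Left multiplication by 1 is β, so the twist on [m] compensates it. *)
- have -> : tinj m = amul (aone : A) (ι (aut m)); last exact: QM.
  by rewrite talg_mul1l autE M_inv.
- rewrite -[x]sweedler_id (linear_sweedler _ _ (@tinj_linear k H M i.+2)).
  have [Q0 QD] := sQ; apply: big_ind => // [u v Qu Qv|[y m] _].
    by rewrite -[u]scale1r; apply: QD.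
  by rewrite tinj_tensor; apply/QM/IH.
Qed.

Lemma talg_aut_mul1 (t : A) m : β (amul t (ι m)) = amul (aut t : A) (ι (aut m)).
Proof.
move: t; apply: (@eq_talg_linear k H M T); [lin|lin|move=> i x].
rewrite talg_mulE autE talg_mulE; case: i x => [c|i x] /=.
  by rewrite autE (linearZ_fun _ _ (hyd_aut_linear hM)).
by rewrite autE (tensor_aut_pure (modE i.+1) hM).
Qed.

(** Hom-associativity with a last factor of degree one. This recursion in the second argument is all
    that later proofs use of the explicit formula for products of higher degree. *)
Lemma talg_mulA1 (x y : A) m :
  amul x (amul y (ι m)) = amul (amul (aut x : A) y) (ι (aut m)).
Proof.
move: x; apply: (@eq_talg_linear k H M T); [lin|lin|move=> i x].
move: y; apply: (@eq_talg_linear k H M T); [lin|lin|move=> j y].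
rewrite autE !talg_mulE.
have tZ n c (z : tpow M n) : @tinj k H M n (c *: z) = c *: @tinj k H M n z.
  exact: (linearZ_fun _ _ (@tinj_linear k H M n)).
have mZl c (u v : A) : amul (c *: u) v = c *: amul u v.
  exact: (linearZ_fun _ _ (talg_mul_bilinear.1 v)).
have mZr c (u v : A) : amul u (c *: v) = c *: amul u v.
  exact: (linearZ_fun _ _ (talg_mul_bilinear.2 u)).
case: j y => [d|j y] /=.
  rewrite tZ mZr; case: i x => [c|i x] /=.
    by rewrite !talg_mulE /= !tZ scalerA mulrC.
  by rewrite (tpow_involutive hH H_inv hM M_inv (i := i.+1) x) tZ mZl !talg_mulE.
case: i x => [c|i x] /=.
  by rewrite !tZ mZl !talg_mulE /= tZ (tensor_aut_pure (modE j.+1) hM).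
rewrite !talg_mulE /= (sweedler_pure (V := tpow M j.+1) (W := M)); last first.
  split=> [n|z]; last exact: (linear_bil2 _ (tpure_bilinear _ _) (hyd_aut_linear hM)).
  exact: (linear_bil1 _ (tpure_bilinear _ _) (@aut_tail_linear j)).
(* Appending [m] to [y] raises by one the power of β on [x]; on the other side this extra power is
   the β already applied to [x]. *)
rewrite (sweedler_pure (V := tpow M j.+1) (W := M)); first by rewrite -iterSr.
split=> [n|z]; last exact: (tpure_bilinear _ _).2.
exact: (linear_bil1 _ (tpure_bilinear _ _) ((tcat_bilinear i j).2 _)).
Qed.

Lemma talg_act_mul1 h (t : A) m : act h (amul t (ι m)) =
  \sw_(p ⊗ q <- cop h) amul (act (α p) t : A) (ι (act (α q) m)).
Proof.
move: t; apply: (@eq_talg_linear k H M T); [lin|lin|move=> i x].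
rewrite talg_mulE; case: i x => [c|i x] /=.
  rewrite actE.
  transitivity (\sw_(p ⊗ q <- cop h) (counit p *:
     (@tinj k H M 1 ((c : k) *: aut (act (α q) m)) : A))).
    rewrite (cop_counitl hH H_inv (F := fun q =>
      @tinj k H M 1 ((c : k) *: aut (act (α q) m)) : A)).
      by rewrite (hyd_aut_act hM) H_inv (linearZ_fun _ _ (hyd_act_linear _ hM)).
    apply: (linear_compose (@tinj_linear k H M 1)); lin.
  apply: eq_sw => p q; rewrite actE talg_mulE /=.
  rewrite -[act (α p) c]/(counit (α p) * c) (counit_aut hH) -scalerA.
  by rewrite !(linearZ_fun _ _ (@tinj_linear k H M 1)).
rewrite actE (tensor_act_pure hH H_inv (modE i.+1) hM).
rewrite (linear_sweedler _ _ (@tinj_linear k H M i.+2)).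
by apply: eq_sw => p q; rewrite actE talg_mulE.
Qed.

Lemma talg_coact_mul1 (t : A) m : coact (amul t (ι m)) =
  \sw_(a ⊗ t0 <- coact t) \sw_(b ⊗ m0 <- coact m) (hmul a b ⊗ (amul t0 (ι m0) : A)).
Proof.
move: t; apply: (@eq_talg_linear k H M (tensor H A)); [lin|lin|move=> i x].
rewrite (sw_talg_coact hH H_inv hM M_inv); last lin.
rewrite talg_mulE; case: i x => [c|i x].
  rewrite sw_unit_coact; last first.
    have bG : is_bilinear (fun a (t0 : A) =>
      \sw_(b ⊗ m0 <- coact m) (hmul a b ⊗ (amul t0 (ι m0) : A))) by lin.
    split=> [y|a]; first exact: bG.1.
    exact: (linear_compose (bG.2 a) (@tinj_linear k H M 0)).
  rewrite /= coactE (linearZ_fun _ _ (hyd_coact_linear hM)).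
  have bF : is_bilinear (fun (a : H) (y : M) => a ⊗ (@tinj k H M 1 y : A)).
    split=> [y|a]; first exact: (tpure_bilinear _ _).1.
    exact: (linear_compose ((tpure_bilinear H A).2 a) (@tinj_linear k H M 1)).
  rewrite (linearZ_fun _ _ (sweedler_linear bF)) (sw_coact_aut hM) //.
  rewrite scale_sw; apply: eq_sw => b m0.
  rewrite (hom_mul1l (hopf_algebra hH)) talg_mulE /=.
  rewrite (linearZ_fun _ _ (@tinj_linear k H M 1)).
  by rewrite (linearZ_fun _ _ ((tpure_bilinear _ _).2 _)).
rewrite /= coactE (tensor_coact_pure hH (modE i.+1) hM).
have bF : is_bilinear (fun (a : H) (y : tpow M i.+2) => a ⊗ (@tinj k H M i.+2 y : A)).
  split=> [y|a]; first exact: (tpure_bilinear _ _).1.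
  exact: (linear_compose ((tpure_bilinear H A).2 a) (@tinj_linear k H M i.+2)).
rewrite sw_sw //; apply: eq_sw => a y; rewrite sw_sw //; apply: eq_sw => b m0.
by rewrite sweedler_pure // talg_mulE.
Qed.

Lemma talg_aut_one : aut (aone : A) = aone.
Proof. exact: (@autE 0 (1 : k)). Qed.

Lemma talg_aut_mul (a b : A) : aut (amul a b) = amul (aut a) (aut b).
Proof.
move: b a; apply: talg_ind.
- by apply: subspace_eq => a; lin.
- by move=> a; rewrite talg_aut_one !talg_mul1r.
move=> b m IH a.
rewrite talg_mulA1 [LHS]talg_aut_mul1 IH [aut (amul b _)]talg_aut_mul1 talg_mulA1.
by rewrite T_inv.
Qed.

Lemma talg_mulA (a b c : A) : amul (aut a) (amul b c) = amul (amul a b) (aut c).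
Proof.
(* The induction hypothesis is needed at (β(a), β(b)), so both arguments stay quantified; they are
   paired because [subspace_eq] has a single parameter. *)
suff E d (p : A * A) : amul (aut p.1) (amul p.2 d) = amul (amul p.1 p.2) (aut d).
  exact: (E c (a, b)).
move: d p; apply: talg_ind => {a b c}.
- by apply: subspace_eq => p; lin.
- by move=> p; rewrite talg_aut_one !talg_mul1r talg_aut_mul.
move=> c m IH [a b] /=; rewrite (talg_mulA1 b) talg_mulA1.
rewrite (IH (aut a, aut b)) /= [aut (amul c _)]talg_aut_mul1 (talg_mulA1 (amul a b)).
by rewrite talg_aut_mul.
Qed.

Lemma talg_act_one h : act h (aone : A) = counit h *: (aone : A).
Proof.
transitivity (@tinj k H M 0 (counit h *: (1 : k^o)) : A).
  exact: (@actE h 0 (1 : k)).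
exact: (linearZ_fun _ _ (@tinj_linear k H M 0)).
Qed.

Lemma talg_coact_one : coact (aone : A) = hone ⊗ (aone : A).
Proof.
apply: etrans (@coactE 0 (1 : k)) _.
rewrite (@sw_unit_coact k H _ (fun a y => a ⊗ (@tinj k H M 0 y : A))) //.
split=> [y|a]; first exact: (tpure_bilinear _ _).1.
exact: (linear_compose ((tpure_bilinear H A).2 a) (@tinj_linear k H M 0)).
Qed.

Lemma talg_act_mul (h : H) (a b : A) : act h (amul a b) =
    \sw_(h1 ⊗ h2 <- comul h) amul (act h1 a) (act h2 b).
Proof.
suff E c (p : H * A) : act p.1 (amul p.2 c) =
    \sw_(h1 ⊗ h2 <- comul p.1) amul (act h1 p.2) (act h2 c).
  exact: (E b (h, a)).
move: c p; apply: talg_ind => {h a b}.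
- by apply: subspace_eq => p; lin.
- move=> [h a] /=; rewrite talg_mul1r.
  have -> : act h (aut a) = aut (act (α h) a).
    by rewrite (hyd_aut_act tensor_alg_module) H_inv.
  rewrite (sw_comul hH) //; last lin.
  rewrite -(cop_counitr hH H_inv (F := fun h => aut (act (α h) a))); last lin.
  apply: eq_sw => p q; rewrite talg_act_one.
  rewrite (counit_aut hH) (linearZ_fun _ _ (talg_mul_bilinear.2 _)).
  by rewrite talg_mul1r.
move=> b m IH [h a] /=; rewrite talg_mulA1 talg_act_mul1.
transitivity (\sw_(p ⊗ q <- cop h) \sw_(c ⊗ d <- cop p)
  amul (amul (act c (aut a)) (act d b) : A) (ι (act (α q) (aut m)))).
  apply: eq_sw => p q; rewrite (IH (α p, aut a)) /=.
  by rewrite (linear_sweedler _ _ (talg_mul_bilinear.1 _)).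
(* The recursion has split [h] as ((c, d), q); coassociativity regroups it as (c, (d, q)), and the
   last two legs act on b m. *)
etransitivity.
  symmetry; refine (cop_coassoc hH H_inv (F := fun c d q =>
    amul (amul (act c (aut a)) (act d b) : A) (ι (act (α q) (aut m)))) _ _ _); lin.
rewrite [RHS](sw_comul hH) //; last lin.
apply: eq_sw => p q; rewrite talg_act_mul1 (sw_cop_aut hH); last lin.
rewrite (linear_sweedler _ _ (talg_mul_bilinear.2 _)).
apply: eq_sw => c d; rewrite !H_inv talg_mulA1 (hyd_aut_act hM).
by rewrite (hyd_aut_act tensor_alg_module) H_inv.
Qed.

Lemma talg_coact_mul (a b : A) : coact (amul a b) =
    \sw_(a' ⊗ a0 <- coact a) \sw_(b' ⊗ b0 <- coact b)
      (hmul a' b' ⊗ (amul a0 b0 : A)).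
Proof.
move: b a; apply: talg_ind.
- by apply: subspace_eq => a; lin.
- move=> a.
  rewrite talg_mul1r (hyd_coact_aut tensor_alg_module); apply: eq_sw => a' a0.
  rewrite talg_coact_one sweedler_pure; last lin.
  by rewrite (hom_mul1r (hopf_algebra hH)) talg_mul1r.
move=> b m IH a.
rewrite talg_mulA1 talg_coact_mul1 IH; etransitivity; first swn.
rewrite (sw_coact_aut tensor_alg_module); last lin.
apply: eq_sw => a' a0; rewrite talg_coact_mul1; symmetry; etransitivity; first swn.
apply: eq_sw => b' b0; rewrite (sw_coact_aut hM); last lin.
apply: eq_sw => m' m0; rewrite talg_mulA1.
by rewrite -(hom_mulA (hopf_algebra hH)) H_inv.
Qed.

Lemma tensor_alg_algebra : hyd_algebra A.
Proof.
split; [exact: tensor_alg_module| |exact: talg_act_mul|exact: talg_act_one|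
  exact: talg_coact_mul|exact: talg_coact_one].
split; [lin|exact: talg_mulA|exact: talg_aut_mul|exact: talg_mul1r|
  exact: talg_mul1l|exact: talg_aut_one].
Qed.

End TensorAlgebraMul.

(** * Hom-ideals and quotients *)

Section Subspaces.
Variables (k : fieldType) (V : lmodType k).
Implicit Types (U S : set V).

Lemma subspaceZ U c x : subspace U -> U x -> U (c *: x).
Proof. by move=> [U0 UD] Ux; rewrite -[X in U X]addr0; apply: UD. Qed.

Lemma subspaceD U x y : subspace U -> U x -> U y -> U (x + y).
Proof. by move=> [U0 UD] Ux Uy; rewrite -[x]scale1r; apply: UD. Qed.

Lemma subspaceB U x y : subspace U -> U x -> U y -> U (x - y).
Proof.
by move=> sU Ux Uy; apply: subspaceD => //; rewrite -scaleN1r; apply: subspaceZ.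
Qed.

Lemma lspan_subspace S : subspace (lspan S).
Proof.
split=> [U [[U0 _] _] //|c x y Sx Sy U US].
by apply: US.1.2; [apply: Sx | apply: Sy].
Qed.

Lemma sub_lspan S : S `<=` lspan S.
Proof. exact: sub_gen_smallest. Qed.

Lemma lspan_sub S U : subspace U -> S `<=` U -> lspan S `<=` U.
Proof. exact: smallest_sub. Qed.

(** By Zorn there is a maximal subspace N that contains [U] and avoids [v]. Then V is the direct sum
    of N and the line through [v], and the functional is the coordinate along [v]. *)
Lemma exists_dual_functional U (v : V) : subspace U -> ~ U v ->
  exists phi : V -> k, [/\ scalar phi, forall u, U u -> phi u = 0 & phi v = 1].
Proof.
move=> sU Uv.
(* Adjoining [U] in the predicate makes the empty chain admissible: its union is empty, and [U]
   itself qualifies. *)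
pose P (X : set V) := subspace (U `|` X) /\ ~ (U `|` X) v.
have [F FP totF|N0 [[sN Nv] maxN]] := Zorn_bigcup (P := P).
  split; last by case=> // -[X /FP[_ +] Xv]; apply; right.
  split; first by left; case: sU.
  have one X c x y : F X -> (U `|` X) x -> (U `|` X) y ->
      (U `|` \bigcup_(X in F) X) (c *: x + y).
    move=> FX Xx Xy; have [[_ XD] _] := FP _ FX.
    by have [Uz|Xz] := XD c _ _ Xx Xy; [left | right; exists X].
  move=> c x y [Ux|[X FX Xx]] [Uy|[Y FY Yy]].
  - by left; apply: sU.2.
  - by apply: one FY _ _; [left | right].
  - by apply: one FX _ _; [right | left].
  - have [XY|YX] := totF X Y FX FY.
      by apply: one FY _ _; right => //; apply: XY.
    by apply: one FX _ _; right => //; apply: YX.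
pose N := U `|` N0.
have UN : U `<=` N by left.
have proj x : exists c, N (x - c *: v).
  have [Nx|Nx] := pselect (N x); first by exists 0; rewrite scale0r subr0.
  (* The span of [x] and N is strictly larger than N, so by maximality it contains v = c x + n. Here
     c is nonzero since N avoids [v], whence x is congruent to c^-1 v modulo N. *)
  pose B := [set y | exists c n, N n /\ y = c *: x + n].
  have NB : N `<=` B by move=> n Nn; exists 0, n; rewrite scale0r add0r.
  have sB : subspace B.
    split; first by apply: NB; case: sN.
    move=> c _ _ [a [n [Nn ->]]] [b [m [Nm ->]]].
    exists (c * a + b), (c *: n + m); split; first exact: sN.2.
    by rewrite scalerDr scalerDl scalerA addrACA.
  have UB : U `|` B = B by apply/setUidPr => u /UN/NB.
  have [[c [n [Nn vE]]]|nBv] := pselect (B v).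
    have c0 : c != 0.
      by apply/eqP => c0; apply: Nv; rewrite vE c0 scale0r add0r.
    exists c^-1; rewrite vE scalerDr scalerA mulVf // scale1r opprD addrA subrr.
    by rewrite add0r -scaleN1r scalerA; apply: subspaceZ.
  have Bx : B x.
    by exists 1, 0; rewrite scale1r addr0; split => //; case: sN.
  case: (maxN B); last by rewrite /P UB.
  split=> [y N0y|BN0]; first by apply: NB; right.
  by apply: Nx; right; apply: BN0.
have [phi phiP] : exists phi : V -> k, forall x, N (x - phi x *: v).
  by exists (fun x => projT1 (cid (proj x))) => x; case: cid.
have phi_uniq x c : N (x - c *: v) -> phi x = c.
  move=> Nc; apply/eqP; rewrite -subr_eq0; apply/negP => /negP d0; apply: Nv.
  rewrite -[v]scale1r -(mulVf d0) -scalerA; apply: subspaceZ => //.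
  have -> : (phi x - c) *: v = (x - c *: v) - (x - phi x *: v).
    by rewrite scalerBl opprB [RHS]addrC addrA subrK.
  exact: (subspaceB sN Nc (phiP x)).
exists phi; split.
- move=> c x y; apply: phi_uniq.
  have -> : c *: x + y - (c * phi x + phi y) *: v =
      c *: (x - phi x *: v) + (y - phi y *: v).
    by rewrite scalerDl opprD addrACA scalerBr scalerA.
  exact: (sN.2 c _ _ (phiP x) (phiP y)).
- by move=> u Uu; apply: phi_uniq; rewrite scale0r subr0; apply: UN.
- by apply: phi_uniq; rewrite scale1r subrr; case: sN.
Qed.

End Subspaces.

(** * Detecting V ⊗ U by contraction *)

Section TensorSubspace.
Variables (k : fieldType) (V W : lmodType k).
Implicit Types (U : set W) (z : tensor V W).

Definition tensor_subspace U : set (tensor V W) :=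
  lspan [set z | exists (v : V) (u : W), U u /\ z = v ⊗ u].

Lemma contraction_bilinear (phi : V -> k) : scalar phi ->
  is_bilinear (fun v (w : W) => phi v *: w).
Proof. by move=> sphi; split=> [w|v]; [apply: linear_scalel | apply: linear_scale]. Qed.

(** Induction on the number of terms. If the first vector [h] is a combination of the other first
    factors, its term is absorbed into the others. Otherwise a functional that is 1 on [h] and 0 on
    the others shows that [a] lies in [U], and the term h ⊗ a can be removed. *)
Lemma tensor_subspace_sum U (s : seq (V * W)) : subspace U ->
  (forall phi : V -> k, scalar phi -> U (\sum_(p <- s) phi p.1 *: p.2)) ->
  tensor_subspace U (\sum_(p <- s) (p.1 ⊗ p.2)).
Proof.
move=> sU; elim: {s}(size s) {-2}s (erefl (size s)) => [|n IH] s.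
  by move/size0nil=> -> _; rewrite big_nil; exact: (lspan_subspace _).1.
case: s => [//|[h a] s] /= [sn] Us.
pose X := [set x | exists g : 'I_n -> k, x = \sum_(i < n) g i *: (nth 0 s i).1].
have sumE (P : lmodType k) (F : V * W -> P) :
    \sum_(p <- s) F p = \sum_(i < n) F (nth 0 s i).
  by rewrite (big_nth 0) big_mkord sn.
have sX : subspace X.
  split; first by exists (fun=> 0); rewrite big1 // => i _; rewrite scale0r.
  move=> c _ _ [f ->] [g ->]; exists (fun i => c * f i + g i).
  rewrite scaler_sumr -big_split; apply: eq_bigr => i _ /=.
  by rewrite scalerDl scalerA.
have [[g hE]|nXh] := pselect (X h).
  pose s' := [seq ((nth 0 s i).1, (nth 0 s i).2 + g i *: a) | i : 'I_n].
  have sE (P : lmodType k) (f : V -> W -> P) : is_bilinear f ->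
      \sum_(p <- (h, a) :: s) f p.1 p.2 = \sum_(p <- s') f p.1 p.2.
    move=> bf; rewrite big_cons sumE big_image /= hE.
    rewrite (linear_sum_fun _ _ _ (bf.1 a)) -big_split /=.
    apply: eq_bigr => i _; rewrite (linearD_fun (bf.2 _)) addrC.
    by rewrite (linearZ_fun _ _ (bf.1 a)) (linearZ_fun _ _ (bf.2 _)).
  rewrite (sE _ _ (tpure_bilinear V W)); apply: IH.
    by rewrite size_map -cardE card_ord.
  by move=> phi sphi; rewrite -(sE _ _ (contraction_bilinear sphi)); apply: Us.
have [phi [sphi phi0 phih]] := exists_dual_functional sX nXh.
have Ua : U a.
  have := Us phi sphi; rewrite big_cons /= phih scale1r sumE big1 ?addr0 // => i _.
  rewrite phi0 ?scale0r //; exists (fun j => (j == i)%:R).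
  rewrite (bigD1 i) //= eqxx scale1r big1 ?addr0 // => j /negbTE->.
  by rewrite scale0r.
rewrite big_cons; apply: (subspaceD (lspan_subspace _)).
  by apply: sub_lspan; exists h, a.
apply: IH => // psi spsi.
have := Us psi spsi; rewrite big_cons /= => Upsi.
rewrite -[X in U X](addKr (psi h *: a)) addrC.
exact: (subspaceB sU Upsi (subspaceZ _ sU Ua)).
Qed.

(* A subspace [U] of the second factor is detected by contracting the first   *)
(* factor with linear functionals; this is where [k] being a field is used.   *)
Lemma tensor_subspaceP U z : subspace U ->
  tensor_subspace U z <->
  (forall phi : V -> k, scalar phi -> U (\sw_(v ⊗ w <- z) (phi v *: w))).
Proof.
move=> sU; split=> [Uz phi sphi|Uz].
  have bphi := contraction_bilinear sphi.
  move: z Uz; apply: lspan_sub => [|_ [v [u [Uu ->]]] /=].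
    split=> [|c x y /= Ux Uy] /=.
      by rewrite (linear_sub0 (sweedler_linear bphi)); case: sU.
    by rewrite (sweedler_linear bphi); apply: sU.2.
  by rewrite sweedler_pure //; apply: subspaceZ.
by rewrite -[z]sweedler_id; apply: tensor_subspace_sum.
Qed.

End TensorSubspace.

(** * Hom-ideals: generation and kernels *)

Section Ideals.
Variables (k : fieldType) (H : homHopf k) (A : hydAlg H).
Hypothesis hA : hyd_algebra A.
Implicit Types (U W : set A).

Let bA := halg_mul_bilinear hA.

Lemma mul_span_mono U U' W W' : U `<=` U' -> W `<=` W' ->
  mul_span U W `<=` mul_span U' W'.
Proof.
move=> UU WW; apply: lspan_sub => [|_ [x [y [Ux Wy ->]]]].
  exact: lspan_subspace.
by apply: sub_lspan; exists x, y; split; [apply: UU | apply: WW |].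
Qed.

Lemma mem_mul_span U W x y : U x -> W y -> mul_span U W (amul x y).
Proof. by move=> Ux Wy; apply: sub_lspan; exists x, y. Qed.

(* (a u) b = β(a) (u β^-1(b)), and β is onto. *)
Lemma mul_span_assoc U :
  mul_span (mul_span setT U) setT = mul_span setT (mul_span U setT).
Proof.
have [_ [g gK Kg]] := hyd_object (halg_module hA).
have assoc := hom_mulA (halg_algebra hA).
apply/seteqP; split; apply: lspan_sub; try exact: lspan_subspace;
  move=> _ [x [y [Ux Uy ->]]].
  have -> : mul_span setT (mul_span U setT) (amul x y) =
    [set x | mul_span setT (mul_span U setT) (amul x y)] x by [].
  move: x Ux; apply: lspan_sub => [|_ [a [u [_ Uu ->]]] /=].
    split=> [|c v w Uv Uw] /=.
      by rewrite (linear_sub0 (bA.1 y)); exact: (lspan_subspace _).1.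
    by rewrite (bA.1 y); apply: (lspan_subspace _).2.
  rewrite -[y]Kg -assoc; apply: mem_mul_span => //; exact: mem_mul_span.
have -> : mul_span (mul_span setT U) setT (amul x y) =
  [set y | mul_span (mul_span setT U) setT (amul x y)] y by [].
move: y Uy; apply: lspan_sub => [|_ [u [b [Uu _ ->]]] /=].
  split=> [|c v w Uv Uw] /=.
    by rewrite (linear_sub0 (bA.2 x)); exact: (lspan_subspace _).1.
  by rewrite (bA.2 x); apply: (lspan_subspace _).2.
rewrite -[x]Kg assoc; apply: mem_mul_span => //; exact: mem_mul_span.
Qed.

(** The coaction condition passes to intersections through [tensor_subspaceP]: every contraction of
    ρ(u) lies in each ideal containing [S]. *)
Lemma hom_ideal_gen (S : set A) : hom_ideal (ideal_gen S).
Proof.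
split.
- exact: ideal_gen_subspace.
- by move=> h u Iu U [iU SU]; apply: (ideal_act iU); apply: Iu.
- move=> u Iu.
  apply/(tensor_subspaceP _ (ideal_gen_subspace S)) => phi sphi U [iU SU].
  apply: ((tensor_subspaceP _ (ideal_subspace iU)).1 _ phi sphi).
  by apply: (ideal_coact iU); apply: Iu.
- by move=> u Iu U [iU SU]; apply: (ideal_aut iU); apply: Iu.
- exact: mul_span_assoc.
move=> u Iu U [iU SU]; apply: (ideal_mul iU); move: u Iu.
apply: mul_span_mono => //; apply: mul_span_mono => // u Iu; exact: Iu.
Qed.

(** For the coaction: if g(u) = 0, contracting ρ(g(u)) = 0 with φ gives g((φ ⊗ 1) ρ(u)) = 0. *)
Lemma hom_ideal_ker (B : hydAlg H) (g : A -> B) : hyd_algebra B ->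
  hyd_algebra_morphism g -> hom_ideal [set a | g a = 0].
Proof.
move=> hB [gH gM g1]; have lg := hmor_linear gH.
have bB := halg_mul_bilinear hB.
have sK := subspace_ker lg.
split => //.
- move=> h u /= gu; rewrite (hmor_act gH) gu.
  exact: (linear_sub0 (hyd_act_linear h (halg_module hB))).
- move=> u /= gu; apply/(tensor_subspaceP _ sK) => phi sphi /=.
  have bphi := @contraction_bilinear k H B phi sphi.
  rewrite linear_sweedler //.
  have := hmor_coact gH u.
  rewrite gu (linear_sub0 (hyd_coact_linear (halg_module hB))) => E.
  have := congr1 (fun t => \sw_(a ⊗ b <- t) (phi a *: b)) E.
  rewrite (linear_sub0 (sweedler_linear bphi)) sw_sw // => {}E.
  rewrite [RHS]E; apply: eq_sw => a b.
  by rewrite sweedler_pure // (linearZ_fun _ _ lg).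
- move=> u /= gu; rewrite (hmor_aut gH) gu.
  exact: (linear_sub0 (hyd_aut_linear (halg_module hB))).
- exact: mul_span_assoc.
apply: lspan_sub => // _ [x [b [xK _ ->]]] /=.
suff -> : g (amul x b) = 0 by [].
have gx : g x = 0.
  move: x xK; apply: (@lspan_sub _ _ _ [set a | g a = 0]) => // _ [a [u [_ gu ->]]] /=.
  by rewrite gM gu (linear_sub0 (bB.2 _)).
by rewrite gM gx (linear_sub0 (bB.1 _)).
Qed.

Hypothesis A_inv : involutive_object A.

(** The ideal axiom bounds only the triple products (AU)A. Here β(au) = (au)1 is one of them, and
    applying β again returns au. *)
Lemma ideal_mull U a u : hom_ideal U -> U u -> U (amul a u).
Proof.
move=> iU Uu; rewrite -[amul a u]A_inv; apply: (ideal_aut iU).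
rewrite -(hom_mul1r (halg_algebra hA)); apply: (ideal_mul iU).
by apply: mem_mul_span => //; apply: mem_mul_span.
Qed.

(** Since u = 1 β(u), the product ua is the triple product (1 β(u)) a. *)
Lemma ideal_mulr U a u : hom_ideal U -> U u -> U (amul u a).
Proof.
move=> iU Uu; rewrite -[u]A_inv -(hom_mul1l (halg_algebra hA)).
apply: (ideal_mul iU); apply: mem_mul_span => //; apply: mem_mul_span => //.
exact: ideal_aut.
Qed.

End Ideals.

(** * The quotient by a Hom-ideal *)

Section Quotient.
Variables (k : fieldType) (H : homHopf k).
Hypotheses (hH : hom_hopf_algebra H) (H_inv : involutive_object H).
Variable A : hydAlg H.
Hypotheses (hA : hyd_algebra A) (A_inv : involutive_object A).
Variables (U : set A) (hU : subspace U).
Hypothesis iU : hom_ideal U.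
Local Notation Q := (quot_alg hU).

Definition quot_proj (a : A) : Q := \pi_(lquot hU) a.
Local Notation π := quot_proj.

Lemma quot_projP a b : π a = π b <-> U (a - b).
Proof. exact: lquotP. Qed.

Lemma quot_proj_linear : linear π.
Proof.
by move=> c x y; rewrite /π -(lquot_piD hU) -(lquot_scale_pi hU).
Qed.
Hint Resolve quot_proj_linear : lin.

Lemma quot_projK (x : Q) : π (repr (x : lquot hU)) = x.
Proof. exact: reprK. Qed.

Lemma quot_reprP (a : A) : U (repr (π a : lquot hU) - a).
Proof. by apply/quot_projP; rewrite quot_projK. Qed.

Lemma quot_ind (P : Q -> Prop) : (forall a, P (π a)) -> forall x, P x.
Proof. by move=> Pa x; rewrite -[x]quot_projK. Qed.

Let mA := halg_module hA.

(** Operations on the quotient are defined through chosen representatives; this removes the choice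
    whenever [f] vanishes on [U]. *)
Lemma quot_lift_linear (P : lmodType k) (f : A -> P) : linear f ->
  (forall u, U u -> f u = 0) -> forall a, f (repr (π a : lquot hU)) = f a.
Proof.
move=> lf fU a; apply/eqP; rewrite -subr_eq0; apply/eqP.
rewrite -[X in _ + X]scaleN1r -(linearZ_fun _ _ lf) -(linearD_fun lf) scaleN1r.
exact/fU/quot_reprP.
Qed.

Lemma quot_proj0 u : U u -> π u = 0.
Proof.
move=> Uu; rewrite -[RHS](linear_sub0 quot_proj_linear).
by apply/quot_projP; rewrite subr0.
Qed.

Lemma quot_aut a : aut (π a) = π (aut a).
Proof.
refine (quot_lift_linear (P := Q) (f := fun a => π (aut a)) _ _ a); first lin.
by move=> u Uu; apply/quot_proj0/(ideal_aut iU).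
Qed.

Lemma quot_act h a : act h (π a) = π (act h a).
Proof.
refine (quot_lift_linear (P := Q) (f := fun a => π (act h a)) _ _ a); first lin.
by move=> u Uu; apply/quot_proj0/(ideal_act iU).
Qed.

Lemma quot_coact a : coact (π a) = \sw_(h ⊗ b <- coact a) (h ⊗ π b).
Proof.
refine (quot_lift_linear (P := tensor H Q)
  (f := fun a => \sw_(h ⊗ b <- coact a) (h ⊗ π b)) _ _ a); first lin.
move=> u /(ideal_coact iU).
have lf : linear (fun t : tensor H A => \sw_(h ⊗ b <- t) (h ⊗ π b)) by lin.
move: (coact u).
apply: (@lspan_sub _ _ _ [set t | \sw_(h ⊗ b <- t) (h ⊗ π b) = 0])
  => [|_ [h [v [Uv ->]]]].
  exact: (subspace_ker lf).
rewrite /mkset sweedler_pure; last lin.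
by rewrite quot_proj0 // (linear_sub0 ((tpure_bilinear _ _).2 _)).
Qed.

Lemma quot_mul a b : amul (π a) (π b) = π (amul a b).
Proof.
apply/quot_projP.
set a' := repr _; set b' := repr _.
(* Each summand has one factor in [U], so the two one-sided ideal properties apply. *)
have -> : amul a' b' - amul a b = amul (a' - a) b' + amul a (b' - b).
  have [bA1 bA2] := halg_mul_bilinear hA.
  by rewrite (linearB_fun (bA1 _)) (linearB_fun (bA2 _)) addrA subrK.
apply: subspaceD => //.
  by apply: ideal_mulr => //; apply: quot_reprP.
by apply: ideal_mull => //; apply: quot_reprP.
Qed.

Lemma sw_quot_coact (P : lmodType k) (F : H -> Q -> P) a : is_bilinear F ->
  sweedler (coact (π a)) F = \sw_(h ⊗ b <- coact a) F h (π b).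
Proof. by move=> bF; rewrite quot_coact; swn. Qed.

Lemma quot_aut_linear : linear (@aut k Q).
Proof.
move=> c; apply: quot_ind => x; apply: quot_ind => y.
rewrite -quot_proj_linear !quot_aut -quot_proj_linear.
by rewrite (hyd_aut_linear mA).
Qed.

Lemma quot_act_bilinear : is_bilinear (@act k H Q).
Proof.
split=> [x c g h|h c].
  move: x; apply: quot_ind => x.
  by rewrite !quot_act -quot_proj_linear ((hyd_act_bilinear mA).1 x).
apply: quot_ind => x; apply: quot_ind => y.
by rewrite -quot_proj_linear !quot_act -quot_proj_linear (hyd_act_linear _ mA).
Qed.

Lemma quot_mul_bilinear : is_bilinear (@amul k H Q).
Proof.
have [bA1 bA2] := halg_mul_bilinear hA.
split=> [z c|z c]; apply: quot_ind => x; apply: quot_ind => y;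
  move: z; apply: quot_ind => z;
  rewrite -quot_proj_linear !quot_mul -quot_proj_linear.
  by rewrite (bA1 z).
by rewrite (bA2 z).
Qed.

Lemma quot_coact_linear : linear (@coact k H Q).
Proof.
have lf : linear (fun a => \sw_(h ⊗ b <- coact a) (h ⊗ π b)) by lin.
move=> c; apply: quot_ind => x; apply: quot_ind => y.
by rewrite -quot_proj_linear !quot_coact lf.
Qed.
Hint Resolve quot_aut_linear quot_act_bilinear quot_coact_linear : lin.

Lemma quot_involutive : involutive_object Q.
Proof. by apply: quot_ind => a; rewrite !quot_aut A_inv. Qed.

Lemma quot_module : hyd_module Q.
Proof.
split; try solve [lin].
- by split; [lin | exact: inv_bij quot_involutive].
- by move=> h g; apply: quot_ind => a; rewrite quot_aut !quot_act (hyd_actA mA).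
- by apply: quot_ind => a; rewrite quot_aut quot_act (hyd_act1 mA).
- by move=> h; apply: quot_ind => a; rewrite !(quot_aut, quot_act) (hyd_aut_act mA).
- rewrite (involutive_iaut H_inv) (involutive_iaut quot_involutive).
  apply: quot_ind => a; rewrite !sw_quot_coact; [|lin..].
  have := hyd_coactA mA a; rewrite (involutive_iaut H_inv) (involutive_iaut A_inv) => E.
  sw_apply E (fun t : tensor H (tensor H A) =>
    \sw_(x ⊗ u <- t) \sw_(y ⊗ b <- u) (x ⊗ (y ⊗ π b))) => {}E.
  etransitivity; [etransitivity; last exact: E |].
    by apply: eq_sw => x b; apply: eq_sw => y z; rewrite quot_aut.
  apply: eq_sw => x b; rewrite quot_coact.
  by rewrite (linear_sweedler _ _ ((tpure_bilinear _ _).2 _)).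
- apply: quot_ind => a; rewrite quot_aut sw_quot_coact; last lin.
  rewrite quot_coact (sw_coact_aut mA); last lin.
  by apply: eq_sw => x b; rewrite quot_aut.
- rewrite (involutive_iaut quot_involutive); apply: quot_ind => a.
  rewrite quot_aut sw_quot_coact; last lin.
  by rewrite (sw_coact_counit mA A_inv _ quot_proj_linear).
- move=> h; rewrite (involutive_iaut H_inv); apply: quot_ind => a.
  rewrite quot_act quot_coact.
  have := hyd_compat mA h a; rewrite (involutive_iaut H_inv) => E.
  sw_apply E (fun t : tensor H A => \sw_(x ⊗ b <- t) (x ⊗ π b)) => {}E.
  rewrite E; apply: eq_sw => p q; apply: eq_sw => c d.
  rewrite sw_quot_coact; last lin.
  by apply: eq_sw => x b; rewrite quot_act.
Qed.

Lemma quot_oneE : aone = π aone.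
Proof. by []. Qed.

Lemma quot_algebra : hyd_algebra Q.
Proof.
have aA := halg_algebra hA.
split; first exact: quot_module.
- split; first exact: quot_mul_bilinear.
  + apply: quot_ind => a; apply: quot_ind => b; apply: quot_ind => c.
    by rewrite !quot_aut !quot_mul (hom_mulA aA).
  + apply: quot_ind => a; apply: quot_ind => b.
    by rewrite !(quot_aut, quot_mul) (hom_aut_mul aA).
  + by apply: quot_ind => a; rewrite quot_oneE quot_mul quot_aut (hom_mul1r aA).
  + by apply: quot_ind => a; rewrite quot_oneE quot_mul quot_aut (hom_mul1l aA).
  + by rewrite quot_oneE quot_aut (hom_aut_one aA).
- move=> h; apply: quot_ind => a; apply: quot_ind => b.
  rewrite quot_mul quot_act (halg_act_mul hA) (linear_sweedler _ _ quot_proj_linear).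
  by apply: eq_sw => x y; rewrite !quot_act quot_mul.
- move=> h; rewrite quot_oneE quot_act (halg_act_one hA).
  exact: (linearZ_fun _ _ quot_proj_linear).
- apply: quot_ind => a; apply: quot_ind => b.
  have bQ := quot_mul_bilinear.
  rewrite quot_mul quot_coact (halg_coact_mul hA) sw_quot_coact; last lin.
  etransitivity; first swn.
  apply: eq_sw => x a0; rewrite sw_quot_coact; last lin.
  by apply: eq_sw => y b0; rewrite quot_mul.
by rewrite quot_oneE quot_coact (halg_coact_one hA) sweedler_pure //; lin.
Qed.

Lemma quot_proj_morphism : hyd_algebra_morphism π.
Proof.
split=> [|a b|]; last by [].
  split; first lin.
  - by move=> h a; rewrite quot_act.
  - by move=> a; rewrite quot_coact.
  - by move=> a; rewrite quot_aut.
by rewrite quot_mul.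
Qed.

End Quotient.

(** * The universal property *)

#[local] Hint Resolve hmor_linear : lin.

Lemma sw_hyd_morphism (k : fieldType) (H : homHopf k) (M N : hyd H) (f : M -> N)
  (P : lmodType k) (F : H -> N -> P) m : hyd_morphism f -> is_bilinear F ->
  sweedler (coact (f m)) F = \sw_(a ⊗ m0 <- coact m) F a (f m0).
Proof. by move=> hf bF; rewrite (hmor_coact hf); swn. Qed.

Lemma hyd_morphism_comp (k : fieldType) (H : homHopf k) (M N P : hyd H)
  (g : N -> P) (f : M -> N) :
  hyd_morphism g -> hyd_morphism f -> hyd_morphism (g \o f).
Proof.
move=> hg hf; split=> [|h m|m|m] /=.
- exact: (linear_compose (hmor_linear hg) (hmor_linear hf)).
- by rewrite (hmor_act hf) (hmor_act hg).
- rewrite (hmor_coact hg) (sw_hyd_morphism _ hf) //; lin.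
- by rewrite (hmor_aut hf) (hmor_aut hg).
Qed.

Lemma hyd_algebra_morphism_comp (k : fieldType) (H : homHopf k)
  (A B C : hydAlg H) (g : B -> C) (f : A -> B) :
  hyd_algebra_morphism g -> hyd_algebra_morphism f ->
  hyd_algebra_morphism (g \o f).
Proof.
move=> [hg gM g1] [hf fM f1]; split=> [|a b|] /=.
- exact: hyd_morphism_comp.
- by rewrite fM gM.
- by rewrite f1 g1.
Qed.

(** * Extension of a map to the tensor algebra *)

Section TensorAlgebraLift.
Variables (k : fieldType) (H : homHopf k).
Hypotheses (hH : hom_hopf_algebra H) (H_inv : involutive_object H).
Variable M : hyd H.
Hypotheses (hM : hyd_module M) (M_inv : involutive_object M).
Local Notation A := (tensor_alg M).
Local Notation ι := (@tinj k H M 1 : M -> A).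

Let hA : hyd_algebra A := tensor_alg_algebra hH H_inv hM M_inv.
Let mA : hyd_module A := halg_module hA.
Let A_inv : involutive_object A := talg_involutive hH H_inv hM M_inv.

Lemma tinj1_morphism : hyd_morphism ι.
Proof.
split=> [|h m|m|m]; first exact: (@tinj_linear k H M 1).
- by rewrite [RHS](@talg_actE k H hH H_inv M hM M_inv h 1 m).
- exact: (@talg_coactE k H hH H_inv M hM M_inv 1 m).
- by rewrite [RHS](@talg_autE k H hH H_inv M hM M_inv 1 m).
Qed.

Variable B : hydAlg H.
Hypothesis hB : hyd_algebra B.
Let bB := halg_mul_bilinear hB.
Let mB := halg_module hB.

Lemma talg_morphism_ext (g g' : A -> B) :
  hyd_algebra_morphism g -> hyd_algebra_morphism g' ->
  (forall m, g (ι m) = g' (ι m)) -> forall t, g t = g' t.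
Proof.
move=> [hg gM g1] [hg' gM' g1'] gg'; apply: talg_ind M_inv _ _ _ _ => //.
- split=> [|c x y gx gy].
    by rewrite !linear_sub0 //; apply: hmor_linear.
  by rewrite (hmor_linear hg) (hmor_linear hg') gx gy.
- by rewrite g1.
- by move=> t m gt; rewrite gM gM' gt gg'.
Qed.

Variable f : M -> B.
Hypothesis hf : hyd_morphism f.

(** The cases mirror those of [tpow], with [f] itself in degree one. The recursive call is handed to
    the inner match as a function because its type depends on [i']. *)
Fixpoint tpow_lift i : tpow M i -> B :=
  match i return tpow M i -> B with
  | 0 => fun c : k => c *: aone
  | i'.+1 =>
      match i' return (tpow M i' -> B) -> tpow M i'.+1 -> B with
      | 0 => fun _ => f
      | i''.+1 => fun g (t : tensor (tpow M i''.+1) M) =>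
          \sw_(x ⊗ m <- t) amul (g x) (f m)
      end (@tpow_lift i')
  end.

Lemma tpow_lift_linear i : linear (@tpow_lift i).
Proof.
elim: i => [|[|i] IH]; first by apply: (linear_scalel (V := k^o)).
  exact: hmor_linear hf.
apply: (sweedler_linear (V := tpow M i.+1) (W := M)); split=> [m|x].
  exact: (linear_bil1 _ bB IH).
exact: (linear_bil2 _ bB (hmor_linear hf)).
Qed.

Definition talg_lift : A -> B := dlift tpow_lift.

Lemma talg_lift_linear : linear talg_lift.
Proof. exact: dlift_linear tpow_lift_linear. Qed.
Hint Resolve talg_lift_linear : lin.

Lemma talg_liftE i (x : tpow M i) : talg_lift (tinj x) = tpow_lift x.
Proof. exact: dlift_inj tpow_lift_linear _ _. Qed.

Lemma talg_lift_one : talg_lift aone = aone.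
Proof. by rewrite [LHS](@talg_liftE 0 (1 : k)) /= scale1r. Qed.

Lemma talg_lift_tinj1 m : talg_lift (ι m) = f m.
Proof. exact: (@talg_liftE 1). Qed.

Lemma talg_lift_mul1 (t : A) m :
  talg_lift (amul t (ι m)) = amul (talg_lift t) (f m).
Proof.
move: t; apply: (@eq_talg_linear k H M B) => [||i x]; [lin|lin|].
rewrite (talg_mulE hH H_inv hM M_inv (j := 1)) !talg_liftE; case: i x => [c|i x].
  rewrite /= talg_liftE /= (linearZ_fun _ _ (hmor_linear hf)) (hmor_aut hf).
  by rewrite (linearZ_fun _ _ (bB.1 _)) (hom_mul1l (halg_algebra hB)).
rewrite /= talg_liftE /= (sweedler_pure (V := tpow M i.+1) (W := M)) //.
split=> [n|y]; last exact: (linear_bil2 _ bB (hmor_linear hf)).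
exact: (linear_bil1 _ bB (@tpow_lift_linear i.+1)).
Qed.

Lemma talg_lift_aut t : talg_lift (aut t) = aut (talg_lift t).
Proof.
move: t; apply: talg_ind M_inv _ _ _ _ => //.
- split=> [|c x y gx gy].
    by rewrite !linear_sub0 //; lin.
  by rewrite (hyd_aut_linear mA) !talg_lift_linear (hyd_aut_linear mB) gx gy.
- rewrite (hom_aut_one (halg_algebra hA)) talg_lift_one.
  by rewrite (hom_aut_one (halg_algebra hB)).
- move=> t m IH; rewrite (hom_aut_mul (halg_algebra hA)) -(hmor_aut tinj1_morphism).
  rewrite !talg_lift_mul1 IH (hmor_aut hf).
  by rewrite (hom_aut_mul (halg_algebra hB)).
Qed.

Lemma talg_lift_act h t : talg_lift (act h t) = act h (talg_lift t).
Proof.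
move: t h; apply: talg_ind M_inv _ _ _ _ => //.
- by apply: subspace_eq => h; lin.
- move=> h; rewrite (halg_act_one hA) (linearZ_fun _ _ talg_lift_linear).
  by rewrite talg_lift_one (halg_act_one hB).
- move=> t m IH h; rewrite (halg_act_mul hA) talg_lift_mul1 (halg_act_mul hB).
  rewrite (linear_sweedler _ _ talg_lift_linear); apply: eq_sw => a b.
  by rewrite -(hmor_act tinj1_morphism) talg_lift_mul1 IH (hmor_act hf).
Qed.

Lemma talg_lift_coact t :
  coact (talg_lift t) = \sw_(a ⊗ t0 <- coact t) (a ⊗ talg_lift t0).
Proof.
move: t; apply: talg_ind M_inv _ _ _ _ => //.
- have l1 : linear (fun t => coact (talg_lift t)) by lin.
  have l2 : linear (fun t : A => \sw_(a ⊗ t0 <- coact t) (a ⊗ talg_lift t0)) by lin.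
  split=> [|c x y gx gy]; first by rewrite (linear_sub0 l1) (linear_sub0 l2).
  by rewrite (l1 c) (l2 c) gx gy.
- rewrite talg_lift_one (halg_coact_one hB) (halg_coact_one hA).
  by rewrite sweedler_pure ?talg_lift_one //; lin.
- move=> t m IH; rewrite talg_lift_mul1 (halg_coact_mul hB) (halg_coact_mul hA).
  rewrite IH; etransitivity; first swn.
  symmetry; etransitivity; first swn.
  apply: eq_sw => a t0; rewrite (sw_hyd_morphism _ tinj1_morphism); last lin.
  rewrite (sw_hyd_morphism _ hf); last lin.
  by apply: eq_sw => b m0; rewrite talg_lift_mul1.
Qed.

(** With F the lift, s (t m) = (β(s) t) β(m) is sent to (F(β(s)) F(t)) β(f(m)) = β(F(β(s))) (F(t)
    f(m)); as F commutes with β, the first factor is F(s). *)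
Lemma talg_lift_mul s t : talg_lift (amul s t) = amul (talg_lift s) (talg_lift t).
Proof.
move: t s; apply: talg_ind M_inv _ _ _ _ => //.
- by apply: subspace_eq => s; lin.
- move=> s; rewrite (hom_mul1r (halg_algebra hA)) talg_lift_one.
  by rewrite (hom_mul1r (halg_algebra hB)) talg_lift_aut.
- move=> t m IH s.
  rewrite -{1}[s]A_inv (hom_mulA (halg_algebra hA)) -(hmor_aut tinj1_morphism).
  rewrite talg_lift_mul1 IH (hmor_aut hf) talg_lift_mul1.
  rewrite -(hom_mulA (halg_algebra hB)).
  by rewrite -talg_lift_aut A_inv.
Qed.

Lemma talg_lift_morphism : hyd_algebra_morphism talg_lift.
Proof.
split; [split | exact: talg_lift_mul | exact: talg_lift_one].
- exact: talg_lift_linear.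
- exact: talg_lift_act.
- exact: talg_lift_coact.
- exact: talg_lift_aut.
Qed.

End TensorAlgebraLift.

(** * The enveloping algebra and its universal property *)

Section Enveloping.
Variables (k : fieldType) (H : homHopf k) (L : homLie H).
Hypotheses (hH : hom_hopf_algebra H) (H_inv : involutive_object H).
Hypotheses (hL : hyd_module L) (L_inv : involutive_object L).
Local Notation T := (tensor_alg L).
Local Notation ι := (@tinj k H L 1 : L -> T).
Local Notation I := (env_ideal (L := L)).
Local Notation U := (env_alg L).
Local Notation π := (quot_proj (env_ideal_subspace L) : T -> U).

Let hT : hyd_algebra T := tensor_alg_algebra hH H_inv hL L_inv.
Let T_inv : involutive_object T := talg_involutive hH H_inv hL L_inv.
Let iI : hom_ideal I := hom_ideal_gen hT _.
Let ιH : hyd_morphism ι := tinj1_morphism hH H_inv hL L_inv.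

Lemma env_relationE x y :
  @tinj k H L 2 (x ⊗ y)
    - @tinj k H L 2 (\sw_(a ⊗ x0 <- coact x) (act a (aut y) ⊗ aut x0))
    - @tinj k H L 1 (bracket x y) =
  amul (ι x) (ι y) - \sw_(a ⊗ x0 <- coact x) amul (ι (act a (aut y))) (ι (aut x0))
    - ι (bracket x y) :> T.
Proof.
rewrite (linear_sweedler _ _ (@tinj_linear k H L 2)).
congr (_ - _ - _); first exact: (@tinj_tensor k H hH H_inv L hL L_inv 0).
by apply: eq_sw => a x0; exact: (@tinj_tensor k H hH H_inv L hL L_inv 0).
Qed.

Lemma env_algebra : hyd_algebra U.
Proof. exact: quot_algebra. Qed.

Let πU : hyd_algebra_morphism π := quot_proj_morphism hT T_inv _ iI.

(** The target [B] is arbitrary, so β^-1 is computed in [L]: β^-1(f(y)) = f(β(y)), because f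
    commutes with β and β^2 = 1 on [L]. *)
Lemma minus_bracket_tail (B : hydAlg H) (f : L -> B) x y :
  hyd_algebra B -> hyd_morphism f ->
  \sw_(h ⊗ b <- coact (f x)) amul (act h (iaut (f y))) (aut b) =
  \sw_(a ⊗ x0 <- coact x) amul (f (act a (aut y))) (f (aut x0)).
Proof.
move=> hB hf; have mB := halg_module hB.
rewrite (sw_hyd_morphism _ hf); last lin.
apply: eq_sw => a x0; rewrite (hmor_act hf) (hmor_aut hf x0).
rewrite (@iaut_eq _ _ _ (f (aut y))) //; first exact: hyd_object.
by rewrite -(hmor_aut hf) L_inv.
Qed.

Lemma env_incl_morphism : @hom_lie_morphism k H L (minus_alg U) (@env_incl k H L).
Proof.
have [πH πM _] := πU; have pH : hyd_morphism (π \o ι) := hyd_morphism_comp πH ιH.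
split=> // x y; have lπ := hmor_linear πH.
change (π (ι (bracket x y)) = amul (π (ι x)) (π (ι y)) -
  \sw_(h ⊗ b <- coact ((π \o ι) x)) amul (act h (iaut ((π \o ι) y))) (aut b)).
rewrite (minus_bracket_tail x y env_algebra pH) -πM.
have -> : \sw_(a ⊗ x0 <- coact x)
      amul ((π \o ι) (act a (aut y))) ((π \o ι) (aut x0)) =
    π (\sw_(a ⊗ x0 <- coact x) amul (ι (act a (aut y))) (ι (aut x0))).
  by rewrite (linear_sweedler _ _ lπ); apply: eq_sw => a x0; rewrite πM.
rewrite -(linearB_fun lπ); symmetry; apply/quot_projP.
by rewrite -env_relationE; apply: sub_gen_smallest; exists x, y.
Qed.

Section Universal.
Variables (B : hydAlg H) (f : L -> B).
Hypotheses (hB : hyd_algebra B) (hf : @hom_lie_morphism k H L (minus_alg B) f).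

Let fH : @hyd_morphism k H L B f := lmor_hyd hf.
Local Notation F := (talg_lift f : T -> B).
Let FM : hyd_algebra_morphism F := talg_lift_morphism hH H_inv hL L_inv hB fH.

(** The kernel of F is an H-Hom-ideal, so by minimality of I only the generators need checking;
    there the claim is that [f] preserves brackets. *)
Lemma env_ideal_lift t : I t -> F t = 0.
Proof.
have [FH Fmul _] := FM; have lF := hmor_linear FH.
have Fι m : F (ι m) = f m by exact: (talg_lift_tinj1 hB fH m).
apply: (smallest_sub (hom_ideal_ker hT hB FM)) => _ [x [y ->]] /=.
rewrite env_relationE !(linearB_fun lF) Fmul !Fι (lmor_bracket hf).
rewrite (linear_sweedler _ _ lF).
apply/eqP; rewrite subr_eq0; apply/eqP; congr (_ - _).
rewrite (minus_bracket_tail x y hB fH).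
by apply: eq_sw => a x0; rewrite Fmul !Fι.
Qed.

Definition env_lift (x : U) : B := F (repr (x : lquot (env_ideal_subspace L))).

Lemma env_liftE t : env_lift (π t) = F t.
Proof.
by apply: quot_lift_linear; [exact: hmor_linear (amor_hyd FM) | exact: env_ideal_lift].
Qed.

Lemma env_lift_morphism : hyd_algebra_morphism env_lift.
Proof.
have [FH Fmul F1] := FM; have lF := hmor_linear FH; have [πH πmul π1] := πU.
have ind := @quot_ind k H T I (env_ideal_subspace L).
have lE : linear env_lift.
  move=> c; apply: (ind) => x; apply: (ind) => y.
  by rewrite -(hmor_linear πH) !env_liftE lF.
split; [split => // | |].
- by move=> h; apply: (ind) => x; rewrite -(hmor_act πH) !env_liftE (hmor_act FH).
- apply: (ind) => x; rewrite env_liftE (hmor_coact FH) (sw_hyd_morphism _ πH).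
    by apply: eq_sw => a y; rewrite env_liftE.
  lin.
- by apply: (ind) => x; rewrite -(hmor_aut πH) !env_liftE (hmor_aut FH).
- by apply: (ind) => x; apply: (ind) => y; rewrite -πmul !env_liftE Fmul.
- by rewrite -π1 env_liftE.
Qed.

Lemma env_lift_incl x : env_lift (env_incl x) = f x.
Proof. by rewrite [LHS]env_liftE; exact: (talg_lift_tinj1 hB fH x). Qed.

Lemma env_morphism_ext (g g' : U -> B) :
  hyd_algebra_morphism g -> hyd_algebra_morphism g' ->
  (forall x, g (env_incl x) = g' (env_incl x)) -> g = g'.
Proof.
move=> hg hg' gg'; apply: funext; apply: (@quot_ind k H T I (env_ideal_subspace L)).
exact: (talg_morphism_ext hH H_inv hL L_inv
  (hyd_algebra_morphism_comp hg πU) (hyd_algebra_morphism_comp hg' πU) gg').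
Qed.

End Universal.

Lemma env_universal : universal_enveloping (@env_incl k H L).
Proof.
split; [exact: env_algebra | exact: env_incl_morphism | move=> B hB f hf].
have hl := env_lift_morphism hB hf.
have fE x : env_lift f (env_incl x) = f x by apply: env_lift_incl hB hf _.
exists (env_lift f); split; first by split => //; apply: funext.
move=> g [hg gE]; apply: env_morphism_ext => // x.
by rewrite fE -gE.
Qed.

End Enveloping.

Theorem theorem4p3 (k : fieldType) (H : homHopf k) (L : homLie H)
  (hH : hom_hopf_algebra H) (H_inv : involutive_object H)
  (hL : braided_hom_lie L) (L_inv : involutive_object L) :
  universal_enveloping (env_incl (L := L)).
Proof. exact: (env_universal hH H_inv (bhl_module hL) L_inv). Qed.
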